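(* Let $p:\mathbb{N}\to(0,1)$ be any function such that $N^{-1}=o(p(N))$ and $p(N)=o(1)$ as $N\to\infty$. For each $N\in\mathbb{N}$ let $A$ be a random subset of $I_N=\{0,1,\dots,N\}$ chosen according to the binomial model with parameter $p(N)$. Then, as $N\to\infty$, the probability that $A$ is difference dominated (that is, $|A-A|>|A+A|$) tends to one. More precisely, let $\mathscr{S}$ and $\mathscr{D}$ denote respectively the random variables $|A+A|$ and $|A-A|$. Then the following three situations arise. (i) If $p(N)=o(N^{-1/2})$, then $$\mathscr{S}\sim\frac{(N\cdot p(N))^2}{2}\quad\text{and}\quad \mathscr{D}\sim 2\mathscr{S}\sim (N\cdot p(N))^2.$$ (ii) If $p(N)=c\cdot N^{-1/2}$ for some $c\in(0,\infty)$, define $g:(0,\infty)\to(0,2)$ by $$g(x):=2\left(\frac{e^{-x}-(1-x)}{x}\right).$$ Then $$\mathscr{S}\sim g\left(\frac{c^2}{2}\right)N\quad\text{and}\quad \mathscr{D}\sim g(c^2)\,N.$$ (iii) If $N^{-1/2}=o(p(N))$, let $\mathscr{S}^c:=(2N+1)-\mathscr{S}$ and $\mathscr{D}^c:=(2N+1)-\mathscr{D}$. Then $$\mathscr{S}^c\sim 2\cdot\mathscr{D}^c\sim\frac{4}{p(N)^2}.$$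
   Context: For a set $A$ of integers, $A+A=\{a_1+a_2:a_1,a_2\in A\}$ and $A-A=\{a_1-a_2:a_1,a_2\in A\}$; $|\cdot|$ denotes cardinality. A finite set $A$ of integers is difference dominated if $|A-A|>|A+A|$. Binomial model with parameter $p(N)$: each $n\in I_N=\{0,1,\dots,N\}$ is placed in $A$ independently with probability $p(N)$. For a real-valued random variable $X$ depending on $N$ and a real-valued function $f(N)$, $X\sim f(N)$ means: for all $\epsilon_1,\epsilon_2>0$ there is $N_{\epsilon_1,\epsilon_2}>0$ such that for all $N>N_{\epsilon_1,\epsilon_2}$, $\mathbb{P}\bigl(X\notin[(1-\epsilon_1)f(N),(1+\epsilon_1)f(N)]\bigr)<\epsilon_2$. The same notation with $f(N)$ replaced by a random variable $Y$ (on the same probability space) has the same meaning with $Y$ in place of $f(N)$. $f=o(g)$ means $\lim_{N\to\infty}f(N)/g(N)=0$. *)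

(* Defs.v *)
From mathcomp Require Import all_boot all_order all_algebra finmap.
From mathcomp Require Import all_classical all_reals all_analysis.

Set Implicit Arguments.
Unset Strict Implicit.
Unset Printing Implicit Defensive.

Import Order.TTheory GRing.Theory Num.Theory.
Import numFieldNormedType.Exports.

Local Open Scope classical_set_scope.
Local Open Scope ring_scope.

Definition sumset (A : {fset int}) : {fset int} :=
  [fset (a1 + a2)%R | a1 in A, a2 in A]%fset.

Definition diffset (A : {fset int}) : {fset int} :=
  [fset (a1 - a2)%R | a1 in A, a2 in A]%fset.

Definition difference_dominated (A : {fset int}) : bool :=
  (#|` sumset A| < #|` diffset A|)%N.

(* The subsets of I_N = {0, ..., N} are the elements of {set 'I_N.+1}; this is
   the same subset seen as a finite set of integers. *)
Definition to_ints (N : nat) (A : {set 'I_N.+1}) : {fset int} :=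
  [fset (nat_of_ord n)%:Z | n in A]%fset.

(* Binomial model: the product of N + 1 Bernoulli(q) laws on the power set of
   I_N, n \in A being the success of the n-th trial. *)
Definition binomial_model (R : realType) (N : nat) (q : R)
    (E : pred {set 'I_N.+1}) : R :=
  \sum_(A : {set 'I_N.+1} | E A)
    \prod_(n < N.+1) (if n \in A then q else 1 - q).

Definition random_variable (R : realType) : Type :=
  forall N : nat, {set 'I_N.+1} -> R.

Definition deterministic (R : realType) (f : nat -> R) : random_variable R :=
  fun N _ => f N.

(* X ~ Y, for A drawn from the binomial model with parameter p N. *)
Definition sim (R : realType) (p : nat -> R) (X Y : random_variable R) : Prop :=
  forall e1 e2 : R, 0 < e1 -> 0 < e2 ->
    exists N0 : nat, forall N : nat, (N0 < N)%N ->
      binomial_model (p N)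
        (fun A => ~~ ((1 - e1) * Y N A <= X N A <= (1 + e1) * Y N A)) < e2.

(* f = o(g) *)
Definition is_o (R : realType) (f g : nat -> R) : Prop :=
  (fun N => f N / g N) @ \oo --> (0 : R).

Definition card_sumset (R : realType) : random_variable R :=
  fun N A => (#|` sumset (to_ints A)|)%:R.

Definition card_diffset (R : realType) : random_variable R :=
  fun N A => (#|` diffset (to_ints A)|)%:R.

Definition missing_sums (R : realType) : random_variable R :=
  fun N A => (2 * N + 1)%:R - card_sumset R A.

Definition missing_diffs (R : realType) : random_variable R :=
  fun N A => (2 * N + 1)%:R - card_diffset R A.

Definition twice (R : realType) (X : random_variable R) : random_variable R :=
  fun N A => 2 * X N A.

Definition g (R : realType) (x : R) : R := 2 * ((expR (- x) - (1 - x)) / x).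

(* Main.v *)
(** Idea.  The event that a given integer is missing from [A + A], or from
    [A - A], or that two given integers are both missing, says that [A] is an
    independent set of a graph of bounded degree on [I_N].  If [q] is the
    sampling probability and [L] the edge set, the probability of independence
    lies between [(1 - q^2)^|L|] and [(1 - q^2 (1 - q)^8)^|L|]: edges are removed
    one at a time, the lower bound by monotonicity, the upper one because the
    neighbours of an edge avoid [A] with probability at least [(1 - q)^8].
    Representations of different integers use disjoint edges, so all first and
    second moments of the number of missing sums or differences reduce to
    geometric sums in [1 - q^2], whatever the size of [N q^2]; Chebyshev's
    inequality then gives concentration around [4 geo (q^2) (N / 2)] and
    [2 geo (q^2) N], which yields (ii) and (iii).  When [N q^2] is small the sums
    and differences themselves have to be counted: [2 |A + A| <= |A|^2 + |A|] and
    [|A - A| <= |A|^2], while the lower bounds on the first moments show that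
    these are nearly equalities on average, so Markov's inequality suffices.
    Difference dominance splits each [N] according to the size of [N q^2]; when
    it is bounded below, [geo (q^2) (2 M)] is smaller than [2 geo (q^2) M] by a
    fixed factor. *)
Require Import Defs.
From mathcomp Require Import all_boot all_order all_algebra finmap.
From mathcomp Require Import all_classical all_reals all_analysis.
From mathcomp Require Import zify ring lra.

Set Implicit Arguments.
Unset Strict Implicit.
Unset Printing Implicit Defensive.

Import Order.TTheory GRing.Theory Num.Theory.
Import numFieldNormedType.Exports.

Local Open Scope classical_set_scope.
Local Open Scope ring_scope.

(** * Random subsets *)

Section RandomSubset.
Variables (R : realType) (T : finType) (q : R).
Implicit Types (A : {set T}) (f g : {set T} -> R) (v : T).

(** Expectation for the law that puts each element of [T] into [A] independently with probability
    [q]. Probabilities enter as expectations of indicators [(b A)%:R]. *)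
Definition Ex f : R := \sum_(A : {set T}) (\prod_v (if v \in A then q else 1 - q)) * f A.

Lemma Ex_const (c : R) : Ex (fun=> c) = c.
Proof.
rewrite /Ex -mulr_suml -[RHS]mul1r; congr (_ * _).
have /= <- := @bigA_distr R 0 1 _ _ T (fun=> q) (fun=> 1 - q).
by rewrite big1 // => i _ /=; rewrite addrC subrK.
Qed.

Lemma eq_Ex f g : f =1 g -> Ex f = Ex g.
Proof. by move=> fg; apply: eq_bigr => A _; rewrite fg. Qed.

Lemma ExD f g : Ex (fun A => f A + g A) = Ex f + Ex g.
Proof. by rewrite /Ex -big_split; apply: eq_bigr => A _ /=; rewrite mulrDr. Qed.

Lemma ExZ (c : R) f : Ex (fun A => c * f A) = c * Ex f.
Proof. by rewrite /Ex mulr_sumr; apply: eq_bigr => A _; rewrite mulrCA. Qed.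

Lemma ExN f : Ex (fun A => - f A) = - Ex f.
Proof. by rewrite -mulN1r -ExZ; apply: eq_Ex => A; rewrite mulN1r. Qed.

Lemma ExB f g : Ex (fun A => f A - g A) = Ex f - Ex g.
Proof. by rewrite ExD ExN. Qed.

Lemma Ex_sum (I : Type) (r : seq I) (P : pred I) (F : I -> {set T} -> R) :
  Ex (fun A => \sum_(i <- r | P i) F i A) = \sum_(i <- r | P i) Ex (F i).
Proof.
by rewrite /Ex exchange_big; apply: eq_bigr => A _; rewrite mulr_sumr.
Qed.

(** Conditioning on whether [v] belongs to [A]. Both conditional expectations are again plain
    expectations, which allows induction on vertices and edges. *)
Lemma Ex_split v f :
  Ex f = q * Ex (fun A => f (v |: A)) + (1 - q) * Ex (fun A => f (A :\ v)).
Proof.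
pose w A : R := \prod_(u | u != v) (if u \in A then q else 1 - q).
have E h : Ex h =
    \sum_(A : {set T} | v \notin A) w A * (q * h (v |: A) + (1 - q) * h A).
  rewrite /Ex (bigID (fun A => v \in A)) /=.
  rewrite [X in X + _](_ : _ = \sum_(A : {set T} | v \notin A) w A * (q * h (v |: A))).
    rewrite -big_split; apply: eq_bigr => A vA /=.
    rewrite (bigD1 v) //= (negbTE vA) mulrDr; congr (_ + _).
    by rewrite -/(w A) mulrCA mulrA.
  (* Sets containing [v] are matched with sets avoiding it by removing [v]. *)
  rewrite (reindex_onto (fun A => v |: A) (fun A => A :\ v)) /=; last first.
    by move=> A vA; rewrite finset.setD1K.
  apply: eq_big => [A|A].
    rewrite !inE eqxx /=; apply/eqP/idP => [<-|vA]; first by rewrite !inE eqxx.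
    by rewrite finset.setU1K.
  rewrite !inE eqxx /= => /eqP vA.
  rewrite (bigD1 v) //= !inE eqxx /= [RHS]mulrCA mulrA; congr (_ * _ * _).
  by apply: eq_bigr => u uv; rewrite !inE (negbTE uv).
rewrite (E f) (E (fun A => f (v |: A))) (E (fun A => f (A :\ v))) !mulr_sumr.
rewrite -big_split; apply: eq_bigr => A vA /=.
rewrite finset.setUA finset.setUid finset.setU1K //.
have -> : A :\ v = A.
  by apply/finset.setP => u; rewrite !inE; case: eqP => // ->; rewrite (negbTE vA).
ring.
Qed.

Hypothesis q01 : 0 < q < 1.

Let q0 : 0 <= q. Proof. by case/andP: q01 => /ltW. Qed.
Let q1 : 0 <= 1 - q. Proof. by case/andP: q01 => _ /ltW; rewrite subr_ge0. Qed.

Lemma Ex_le f g : (forall A, f A <= g A) -> Ex f <= Ex g.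
Proof.
move=> fg; apply: ler_sum => A _; apply: ler_wpM2l => //.
by apply: prodr_ge0 => v _; case: ifP.
Qed.

Lemma Ex_ge0 f : (forall A, 0 <= f A) -> 0 <= Ex f.
Proof. by move=> f0; rewrite -(Ex_const 0); apply: Ex_le. Qed.

Lemma Ex_markov f (b : pred {set T}) (t : R) :
    0 < t -> (forall A, 0 <= f A) -> (forall A, b A -> t <= f A) ->
  Ex (fun A => (b A)%:R) <= Ex f / t.
Proof.
move=> t0 f0 bf; rewrite mulrC -ExZ; apply: Ex_le => A.
case: (boolP (b A)) => [/bf h|_]; first by rewrite ler_pdivlMl ?mulr1.
by rewrite mulr_ge0 // invr_ge0 ltW.
Qed.

Definition decreasing f := forall A v, f (v |: A) <= f A.

Lemma decreasing_setD1 f A v : decreasing f -> f A <= f (A :\ v).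
Proof.
move=> df; case: (boolP (v \in A)) => vA; first by rewrite -{1}(finset.setD1K vA).
rewrite (_ : A :\ v = A) //; apply/finset.setP => u.
by rewrite !inE; case: eqP => // ->; rewrite (negbTE vA).
Qed.

Lemma Ex_mem v f :
  Ex (fun A => f A * (v \in A)%:R) = q * Ex (fun A => f (v |: A)).
Proof.
rewrite (Ex_split v).
under eq_Ex do rewrite finset.setU11 mulr1.
under [X in _ + _ * X]eq_Ex do rewrite finset.setD11 mulr0.
by rewrite Ex_const mulr0 addr0.
Qed.

Lemma Ex_nmem v f :
  Ex (fun A => f A * (v \notin A)%:R) = (1 - q) * Ex (fun A => f (A :\ v)).
Proof.
rewrite (Ex_split v).
under eq_Ex do rewrite finset.setU11 mulr0.
under [X in _ + _ * X]eq_Ex do rewrite finset.setD11 mulr1.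
by rewrite Ex_const mulr0 add0r.
Qed.

(** The one-vertex case of Harris's correlation inequality: forcing [v] into [A] can only lower a
    decreasing [f]. *)
Lemma Ex_mem_le v f : decreasing f -> Ex (fun A => f A * (v \in A)%:R) <= q * Ex f.
Proof. by move=> df; rewrite Ex_mem; apply: ler_wpM2l => //; apply: Ex_le. Qed.

Lemma Ex_nmem_ge v f :
  decreasing f -> (1 - q) * Ex f <= Ex (fun A => f A * (v \notin A)%:R).
Proof.
move=> df; rewrite Ex_nmem; apply: ler_wpM2l => //; apply: Ex_le => A.
exact: decreasing_setD1.
Qed.

Definition avoids (s : seq T) A := all (fun v => v \notin A) s.

(** The product of [f] with an avoidance indicator is still decreasing, so each further vertex costs
    at most a factor [1 - q]. Repetitions in [s] only weaken the bound. *)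
Lemma Ex_avoids_ge (s : seq T) f : decreasing f -> (forall A, 0 <= f A) ->
  (1 - q) ^+ size s * Ex f <= Ex (fun A => f A * (avoids s A)%:R).
Proof.
move=> + f0; elim: s => [|v s IH] /= df.
  by rewrite expr0 mul1r; apply: Ex_le => A; rewrite mulr1.
rewrite exprS -mulrA (le_trans (ler_wpM2l q1 (IH df))) //.
have dg : decreasing (fun A => f A * (avoids s A)%:R).
  move=> A u /=; apply: ler_pM => //; rewrite ler_nat.
  case: (boolP (avoids s (u |: A))) => // /allP h.
  suff -> : avoids s A by [].
  by apply/allP => x /h; rewrite !inE negb_or => /andP[].
apply: le_trans (Ex_nmem_ge v dg) _; apply: Ex_le => A.
by rewrite -mulrA -natrM mulnb andbC.
Qed.

(** [L] is read as the edge list of a graph in which [A] is to be an independent set. *)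
Definition indep (L : seq (T * T)) A := all (fun e => ~~ ((e.1 \in A) && (e.2 \in A))) L.

Lemma indep_decreasing L : decreasing (fun A => (indep L A)%:R).
Proof.
move=> A v; rewrite ler_nat; case: (boolP (indep L (v |: A))) => // /allP h.
suff -> : indep L A by [].
apply/allP => e /h; apply: contra => /andP[e1 e2].
by rewrite !inE e1 e2 !orbT.
Qed.

Lemma Ex_indep_cons (e : T * T) L :
  Ex (fun A => (indep (e :: L) A)%:R) = Ex (fun A => (indep L A)%:R) -
  Ex (fun A => (indep L A)%:R * (e.1 \in A)%:R * (e.2 \in A)%:R).
Proof.
rewrite -ExB; apply: eq_Ex => A /=; rewrite -!natrM !mulnb -!/(indep L A).
by case: (indep L A); case: (_ \in A); case: (_ \in A); rewrite ?subrr ?subr0.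
Qed.

(** Containing both ends of a new edge is negatively correlated with independence for the other
    edges, so each edge costs at most a factor [1 - q ^+ 2]. *)
Lemma Ex_indep_ge (L : seq (T * T)) : all (fun e => e.1 != e.2) L ->
  (1 - q ^+ 2) ^+ size L <= Ex (fun A => (indep L A)%:R).
Proof.
have q2 : 0 <= 1 - q ^+ 2 by rewrite subr_ge0 exprn_ile1 // -subr_ge0.
elim: L => [|e L IH] /=; first by rewrite Ex_const expr0.
case/andP => e12 /IH {}IH; rewrite exprS Ex_indep_cons.
apply: (@le_trans _ _ ((1 - q ^+ 2) * Ex (fun A => (indep L A)%:R))).
  exact: ler_wpM2l.
rewrite mulrBl mul1r lerD2l lerN2 Ex_mem.
rewrite expr2 -mulrA ler_wpM2l //.
rewrite (le_trans _ (Ex_mem_le e.1 (indep_decreasing L))) //.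
apply: Ex_le => A; apply: ler_pM => //; first exact: indep_decreasing.
by rewrite !inE (negbTE e12).
Qed.

(* If every vertex has few neighbours, then given that no edge of [L] lies in
   [A], the two ends of a further edge are both free to enter [A] as soon as
   their neighbours stay out of it. *)
Lemma Ex_indep_le (lt : rel T) (nb : T -> seq T) (m : nat) (L : seq (T * T)) :
    irreflexive lt -> antisymmetric lt -> uniq L ->
    (forall v, size (nb v) <= m)%N ->
    (forall e, e \in L -> [/\ lt e.1 e.2, e.2 \in nb e.1 & e.1 \in nb e.2]) ->
  Ex (fun A => (indep L A)%:R) <= (1 - q ^+ 2 * (1 - q) ^+ (m + m)) ^+ size L.
Proof.
move=> ltI ltA + nbm; set s := q ^+ 2 * _.
have q1' : (1 - q) ^+ (m + m) <= 1 by apply: exprn_ile1 => //; move: q0; lra.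
have q1'' : 0 <= (1 - q) ^+ (m + m) by apply: exprn_ge0.
have s1 : 0 <= 1 - s.
  by rewrite /s subr_ge0 mulr_ile1 ?exprn_ge0 ?exprn_ile1 //; move: q0 q1; lra.
elim: L => [|[u v] L IH]; first by rewrite Ex_const expr0.
rewrite cons_uniq => /andP[uvL uL] HL; rewrite exprS Ex_indep_cons /=.
have {}IH : Ex (fun A => (indep L A)%:R) <= (1 - s) ^+ size L.
  by apply: IH => // e eL; apply: HL; rewrite inE eL orbT.
apply: le_trans (ler_wpM2l s1 IH).
rewrite mulrBl mul1r lerD2l lerN2 /s -mulrA.
have [/= ltuv _ _] := HL (u, v) (mem_head _ _).
have uv : u != v by apply: contraTneq ltuv => ->; rewrite ltI.
have -> : Ex (fun A => (indep L A)%:R * (u \in A)%:R * (v \in A)%:R) =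
    q ^+ 2 * Ex (fun A => (indep L (v |: (u |: A)))%:R).
  rewrite Ex_mem expr2 -mulrA; congr (_ * _).
  rewrite -(Ex_mem u (fun A => (indep L (v |: A))%:R)).
  by apply: eq_Ex => A; rewrite !inE (negbTE uv).
apply: ler_wpM2l; first exact: exprn_ge0.
pose N := nb u ++ nb v.
have Nm : (size N <= m + m)%N by rewrite size_cat leq_add.
have q1e : (1 - q) ^+ (m + m) <= (1 - q) ^+ size N.
  by apply: ler_wiXn2l => //; move: q0; lra.
apply: le_trans (_ : (1 - q) ^+ size N * Ex (fun A => (indep L A)%:R) <= _).
  by apply: ler_wpM2r => //; apply: Ex_ge0.
apply: le_trans (Ex_avoids_ge N (indep_decreasing L) _) _ => //.
apply: Ex_le => A; rewrite -natrM mulnb ler_nat.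
case: (boolP (_ && _)) => // /andP[/allP iA /allP NA].
suff -> : indep L (v |: (u |: A)) by [].
apply/allP => -[a b] abL; have := iA _ abL.
have [/= ltab bna anb] := HL (a, b) (mem_behead (s := (u,v) :: L) abL).
have Nin x y : x \in nb y -> y \in [:: u; v] -> x \notin A.
  by move=> xy; rewrite !inE => yuv; apply: NA; rewrite mem_cat;
    case/orP: yuv => /eqP <-; rewrite xy ?orbT.
move=> abA; apply/negP => /=.
have vuE x : (x \in v |: (u |: A)) = (x \in [:: u; v]) || (x \in A).
  by rewrite !inE orbA [(x == v) || _]orbC.
(* An edge with both ends in [[:: u; v]] is a loop, the edge [(u, v)] itself, excluded by [uniq], or
   its reversal, excluded by the orientation [lt]. An edge with one end there has a neighbour of [u]
   or [v] as its other end, which avoids [A]. An edge inside [A] contradicts independence. *)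
rewrite !vuE => /andP[/orP[auv|aA] /orP[buv|bA]].
- move: auv buv ltab abL; rewrite !inE.
  move=> /orP[] /eqP-> /orP[] /eqP->; rewrite ?ltI //.
  + by rewrite (negbTE uvL).
  + by move=> ltvu _; move: uv; rewrite (ltA u v) ?ltuv ?eqxx.
- by have := Nin _ _ bna auv; rewrite bA.
- by have := Nin _ _ anb buv; rewrite aA.
- by rewrite aA bA in abA.
Qed.

(** The off-diagonal terms are at most those of the square of [\sum_i x i], and the diagonal adds
    only [\sum_i x i]: the second moment exceeds the square by a term of first order. *)
Lemma Ex_sqr_sum_le (I : finType) (Z : I -> {set T} -> R) (x : I -> R) :
    (forall i, 0 <= x i) -> (forall i, Ex (fun A => Z i A ^+ 2) <= x i) ->
    (forall i j, i != j -> Ex (fun A => Z i A * Z j A) <= x i * x j) ->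
  Ex (fun A => (\sum_i Z i A) ^+ 2) <= (\sum_i x i) ^+ 2 + \sum_i x i.
Proof.
move=> x0 xd xo; pose d i j := Ex (fun A => Z i A * Z j A).
have -> : Ex (fun A => (\sum_i Z i A) ^+ 2) = \sum_i \sum_j d i j.
  rewrite -[RHS](_ : Ex (fun A => \sum_i \sum_j Z i A * Z j A) = _).
    by apply: eq_Ex => A; rewrite expr2 mulr_suml; apply: eq_bigr => i _; rewrite mulr_sumr.
  by rewrite Ex_sum; apply: eq_bigr => i _; rewrite Ex_sum.
rewrite expr2 mulr_suml -big_split; apply: ler_sum => i _ /=.
rewrite mulr_sumr (bigD1 i) //= addrC lerD //; last first.
  by rewrite /d; under eq_Ex do rewrite -expr2.
apply: le_trans (_ : \sum_(j | j != i) x i * x j <= _).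
  by apply: ler_sum => j ji; apply: xo; rewrite eq_sym.
by rewrite [leRHS](bigD1 i) //= lerDr mulr_ge0.
Qed.

End RandomSubset.

(** * Representations as sums and differences *)

Section Representations.
Variable N : nat.
Implicit Types (A : {set 'I_N.+1}) (k d : nat).

Definition has_sum A k := [exists i in A, exists j in A, (i + j == k)%N].
Definition has_diff A d := [exists i in A, exists j in A, (i + d == j)%N].

Lemma has_sumP A k :
  reflect (exists i j, [/\ i \in A, j \in A & (i + j = k)%N]) (has_sum A k).
Proof.
apply: (iffP exists_inP) => [[i iA /exists_inP[j jA /eqP ijk]]|[i [j [iA jA ijk]]]].
  by exists i, j.
by exists i => //; apply/exists_inP; exists j => //; apply/eqP.
Qed.

Lemma has_diffP A d :
  reflect (exists i j, [/\ i \in A, j \in A & (i + d = j)%N]) (has_diff A d).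
Proof.
apply: (iffP exists_inP) => [[i iA /exists_inP[j jA /eqP ijk]]|[i [j [iA jA ijk]]]].
  by exists i, j.
by exists i => //; apply/exists_inP; exists j => //; apply/eqP.
Qed.

Lemma mem_to_intsP A (z : int) :
  reflect (exists2 i, i \in A & z = (nat_of_ord i)%:Z) (z \in to_ints A).
Proof. by apply: (iffP (imfsetP _ _ _ _)) => -[i iA ->]; exists i. Qed.

Lemma card_fset_ord (B : {fset int}) (m : nat) (h : 'I_m -> int) (P : pred 'I_m) :
    injective h -> (forall z, reflect (exists2 k, P k & z = h k) (z \in B)) ->
  #|` B| = (\sum_k P k)%N.
Proof.
move=> hI hB; have -> : B = [fset h k | k in P]%fset.
  by apply/fsetP => z; apply/hB/imfsetP => -[k Pk ->]; exists k.
by rewrite card_imfset // -cardE -sum1_card [LHS]big_mkcond.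
Qed.

Lemma card_sumsetE A :
  #|` sumset (to_ints A)| = (\sum_(k < (2 * N).+1) has_sum A k)%N.
Proof.
apply: (@card_fset_ord _ _ (fun k : 'I__ => (nat_of_ord k)%:Z) (fun k : 'I__ => has_sum A k)).
  by move=> i j [] /ord_inj.
move=> z; apply: (iffP (imfset2P _ _ _ _ _)) => /=.
  move=> [_ /mem_to_intsP[i iA ->] [_ /mem_to_intsP[j jA ->] ->]].
  have ijN : (i + j < (2 * N).+1)%N by have := ltn_ord i; have := ltn_ord j; lia.
  by exists (Ordinal ijN) => //=; apply/has_sumP; exists i, j.
move=> [k /has_sumP[i [j [iA jA ijk]]] ->].
exists (nat_of_ord i)%:Z; first by apply/mem_to_intsP; exists i.
by exists (nat_of_ord j)%:Z; [apply/mem_to_intsP; exists j|rewrite -ijk].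
Qed.

(** [has_diff] records nonnegative differences only; by symmetry a positive one counts twice, and
    zero once. *)
Lemma card_diffsetE A :
  #|` diffset (to_ints A)| = ((\sum_(d < N) has_diff A d.+1).*2 + has_diff A 0)%N.
Proof.
(* The index [k] encodes the difference [k - N], which runs from [- N] to [N]. *)
pose P (k : nat) := if (k <= N)%N then has_diff A (N - k) else has_diff A (k - N).
rewrite (@card_fset_ord _ (N.+1 + N)
  (fun k : 'I__ => (nat_of_ord k)%:Z - N%:Z) (fun k : 'I__ => P k)).
- rewrite big_split_ord /= big_ord_recr /= {2}/P leqnn subnn addnAC -addnn.
  congr (_ + _ + _)%N; last first.
    by apply: eq_bigr => i _; rewrite /P; case: ifP; [lia|rewrite addSnnS addKn].
  rewrite (reindex_inj rev_ord_inj) /=; apply: eq_bigr => i _.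
  have iN := ltn_ord i.
  by rewrite /P (_ : N - i.+1 <= N)%N ?leq_subr // (_ : N - (N - i.+1) = i.+1)%N //; lia.
- by move=> i j /addIr[] /ord_inj.
move=> z; apply: (iffP (imfset2P _ _ _ _ _)) => /=.
  move=> [_ /mem_to_intsP[i iA ->] [_ /mem_to_intsP[j jA ->] ->]].
  have iN := ltn_ord i; have jN := ltn_ord j.
  have ijN : (i + N - j < N.+1 + N)%N by lia.
  exists (Ordinal ijN) => /=; last by lia.
  by rewrite /P; case: ifP => h; apply/has_diffP; [exists i, j|exists j, i]; split => //; lia.
move=> [k + ->]; rewrite /P; case: ifP => h /has_diffP[i [j [iA jA ijk]]].
  exists (nat_of_ord i)%:Z; first by apply/mem_to_intsP; exists i.
  by exists (nat_of_ord j)%:Z; [apply/mem_to_intsP; exists j|lia].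
exists (nat_of_ord j)%:Z; first by apply/mem_to_intsP; exists j.
by exists (nat_of_ord i)%:Z; [apply/mem_to_intsP; exists i|lia].
Qed.

(** The number of pairs [a < b] in the interval with [a + b = k]. By truncated subtraction [k - N]
    is the least possible [a], so one formula serves both [k <= N] and [k > N]. *)
Definition halfgap k := (k - (k - N).*2).+1./2.

(** The pairs are listed from the outermost inwards. The representation of an even [k] as twice its
    half is left out, since it is not an edge. *)
Definition sum_edges k : seq ('I_N.+1 * 'I_N.+1) :=
  [seq (inord (k - N + i), inord (k - (k - N) - i)) | i <- iota 0 (halfgap k)].

Definition diff_edges d : seq ('I_N.+1 * 'I_N.+1) :=
  [seq (inord i, inord (i + d)) | i <- iota 0 (N.+1 - d)].

Lemma size_sum_edges k : size (sum_edges k) = halfgap k.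
Proof. by rewrite size_map size_iota. Qed.

Lemma size_diff_edges d : size (diff_edges d) = (N.+1 - d)%N.
Proof. by rewrite size_map size_iota. Qed.

Lemma mem_sum_edges k (e : 'I_N.+1 * 'I_N.+1) : (k <= 2 * N)%N ->
  (e \in sum_edges k) = (e.1 < e.2)%N && (e.1 + e.2 == k)%N.
Proof.
move=> kN; rewrite /halfgap; apply/mapP/andP => [[i]|].
  rewrite mem_iota /halfgap => iN -> /=.
  by rewrite !inordK; [split; [lia|apply/eqP; lia]|lia|lia].
case: e => -[a aN] [b bN] /= [ab /eqP abk]; exists (a - (k - N))%N.
  by rewrite mem_iota /halfgap; lia.
by congr pair; apply: val_inj; rewrite /= inordK; lia.
Qed.

Lemma mem_diff_edges d (e : 'I_N.+1 * 'I_N.+1) :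
  (e \in diff_edges d) = (e.1 + d == e.2)%N.
Proof.
apply/mapP/eqP => [[i]|].
  by rewrite mem_iota => iN -> /=; rewrite !inordK; lia.
case: e => -[a aN] [b bN] /= abd; exists a; first by rewrite mem_iota; lia.
by congr pair; apply: val_inj; rewrite /= inordK; lia.
Qed.

Lemma uniq_sum_edges k : (k <= 2 * N)%N -> uniq (sum_edges k).
Proof.
move=> kN; rewrite map_inj_in_uniq ?iota_uniq // => i j.
rewrite !mem_iota /halfgap => iN jN [/(congr1 (@nat_of_ord _)) + _].
by rewrite !inordK; lia.
Qed.

Lemma uniq_diff_edges d : uniq (diff_edges d).
Proof.
rewrite map_inj_in_uniq ?iota_uniq // => i j.
rewrite !mem_iota => iN jN [/(congr1 (@nat_of_ord _)) + _].
by rewrite !inordK; lia.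
Qed.

Lemma indep_sum_edges A k : (k <= 2 * N)%N -> ~~ has_sum A k -> indep (sum_edges k) A.
Proof.
move=> kN; apply: contraR => /allPn[e]; rewrite mem_sum_edges // negbK.
move=> /andP[_ /eqP ek] /andP[e1 e2].
by apply/has_sumP; exists e.1, e.2.
Qed.

(** The only representation not listed in [sum_edges] is the doubled middle, which is kept out of
    [A] separately. *)
Lemma nhas_sum A k : (k <= 2 * N)%N ->
  indep (sum_edges k) A -> inord k./2 \notin A -> ~~ has_sum A k.
Proof.
move=> kN /allP iA kA; apply/has_sumP => -[i [j [Ai Aj ijk]]].
have no (a b : 'I_N.+1) : (a < b)%N -> (a + b = k)%N -> a \in A -> b \in A -> False.
  move=> ab abk aA bA; have := iA (a, b).
  by rewrite mem_sum_edges //= ab abk eqxx aA bA => /(_ isT).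
have [ij|ji|ij] := ltngtP i j; first exact: (no i j).
- by apply: (no j i) => //; rewrite addnC.
- move: kA; rewrite -ijk ij addnn doubleK (_ : inord _ = j) ?Aj //.
  by apply: val_inj; rewrite /= inordK.
Qed.

Lemma nhas_diff A d : ~~ has_diff A d = indep (diff_edges d) A.
Proof.
apply/idP/allP => [/has_diffP nA e|iA].
  rewrite mem_diff_edges => /eqP ed; apply/negP => /andP[e1 e2].
  by apply: nA; exists e.1, e.2.
apply/has_diffP => -[i [j [Ai Aj ij]]]; have := iA (i, j).
by rewrite mem_diff_edges /= ij eqxx Ai Aj => /(_ isT).
Qed.

End Representations.

(** * Probabilities that one or two given values are missing *)

Section Probabilities.
Variables (R : realType) (N : nat) (q : R).
Hypothesis q01 : 0 < q < 1.
Local Notation Ex := (@Ex R 'I_N.+1 q).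
Local Notation rho := (1 - q ^+ 2 * (1 - q) ^+ 8).

Lemma ltn_ord_irr : irreflexive (fun i j : 'I_N.+1 => (i < j)%N).
Proof. by move=> i; rewrite ltnn. Qed.

Lemma ltn_ord_anti : antisymmetric (fun i j : 'I_N.+1 => (i < j)%N).
Proof. by move=> i j /andP[ij ji]; apply: val_inj => /=; lia. Qed.

(** Neighbours are computed as natural numbers; [insub] drops those that exceed [N]. *)
Definition ords (s : seq nat) : seq 'I_N.+1 := pmap insub s.

Lemma size_ords s : (size (ords s) <= size s)%N.
Proof. by rewrite size_pmap_sub count_size. Qed.

(** The neighbours of [v] are among [k - v] and [l - v]. The degree bound 4 is generous, so that the
    same [rho] serves sums and differences; [k = l] covers a single value. *)
Lemma sum_indep_le k l (L : seq ('I_N.+1 * 'I_N.+1)) : uniq L ->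
    (forall e, e \in L -> (e.1 < e.2)%N /\ ((e.1 + e.2 == k)%N || (e.1 + e.2 == l)%N)) ->
  Ex (fun A => (indep L A)%:R) <= rho ^+ size L.
Proof.
move=> uL HL; pose nb (v : 'I_N.+1) := ords [:: k - v; l - v]%N.
apply: (Ex_indep_le q01 ltn_ord_irr ltn_ord_anti (nb := nb) (m := 4)) => // [v|e /HL[e12 ekl]].
  exact: leq_trans (size_ords _) _.
by split=> //; rewrite /nb /ords mem_pmap_sub !inE /=;
  case/orP: ekl => /eqP <-; rewrite ?addKn ?addnK eqxx ?orbT.
Qed.

(** The neighbours of [v] are among [v + k], [v + l], [v - k] and [v - l]; this is the origin of the
    exponent 8 in [rho]. *)
Lemma diff_indep_le k l (L : seq ('I_N.+1 * 'I_N.+1)) : uniq L ->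
    (forall e, e \in L -> (e.1 < e.2)%N /\ ((e.1 + k == e.2)%N || (e.1 + l == e.2)%N)) ->
  Ex (fun A => (indep L A)%:R) <= rho ^+ size L.
Proof.
move=> uL HL; pose nb (v : 'I_N.+1) := ords [:: v + k; v + l; v - k; v - l]%N.
apply: (Ex_indep_le q01 ltn_ord_irr ltn_ord_anti (nb := nb) (m := 4)) => // [v|e /HL[e12 ekl]].
  exact: leq_trans (size_ords _) _.
by split=> //; rewrite /nb /ords mem_pmap_sub !inE /=;
  case/orP: ekl => /eqP <-; rewrite ?addKn ?addnK eqxx ?orbT.
Qed.

Lemma uniq_cat_edges (P Q : pred ('I_N.+1 * 'I_N.+1)) L L' :
    uniq L -> uniq L' -> {in L, forall e, P e} -> {in L', forall e, Q e} ->
    (forall e, P e -> ~~ Q e) ->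
  uniq (L ++ L').
Proof.
move=> uL uL' LP LQ PQ; rewrite cat_uniq uL uL' andbT /=.
by apply/hasPn => e /LQ Qe; apply/negP => /LP /PQ; rewrite Qe.
Qed.

Lemma indep_cat L L' (A : {set 'I_N.+1}) : indep (L ++ L') A = indep L A && indep L' A.
Proof. exact: all_cat. Qed.

Lemma Ex_nhas_sum_le k : (k <= 2 * N)%N ->
  Ex (fun A => (~~ has_sum A k)%:R) <= rho ^+ halfgap N k.
Proof.
move=> kN; rewrite -size_sum_edges.
apply: le_trans (@sum_indep_le k k _ (uniq_sum_edges kN) _).
  apply: Ex_le => // A; rewrite ler_nat; case: (boolP (~~ has_sum A k)) => //.
  by move=> /(indep_sum_edges kN) ->.
by move=> e; rewrite mem_sum_edges // => /andP[-> ->].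
Qed.

(** Different sums are represented by disjoint sets of edges, so the exponents add and the bound
    factorises as if the two events were independent. *)
Lemma Ex_nhas_sum2_le k l : (k <= 2 * N)%N -> (l <= 2 * N)%N -> k != l ->
  Ex (fun A => (~~ has_sum A k)%:R * (~~ has_sum A l)%:R)
    <= rho ^+ halfgap N k * rho ^+ halfgap N l.
Proof.
move=> kN lN kl; rewrite -exprD -(size_sum_edges N k) -(size_sum_edges N l) -size_cat.
apply: le_trans (@sum_indep_le k l _ _ _).
- apply: Ex_le => // A; rewrite -natrM mulnb ler_nat.
  case: (boolP (_ && _)) => // /andP[/(indep_sum_edges kN) Ak /(indep_sum_edges lN) Al].
  by rewrite indep_cat Ak Al.
- apply: (@uniq_cat_edges (fun e => e.1 + e.2 == k)%N (fun e => e.1 + e.2 == l)%N).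
  + exact: uniq_sum_edges.
  + exact: uniq_sum_edges.
  + by move=> e; rewrite mem_sum_edges // => /andP[].
  + by move=> e; rewrite mem_sum_edges // => /andP[].
  + by move=> e /eqP->.
- move=> e; rewrite mem_cat !mem_sum_edges // => /orP[] /andP[-> ->] //.
  by rewrite orbT.
Qed.

(** The factor [1 - q] pays for keeping the middle [k./2] out of [A]. *)
Lemma Ex_nhas_sum_ge k : (k <= 2 * N)%N ->
  (1 - q) * (1 - q ^+ 2) ^+ halfgap N k <= Ex (fun A => (~~ has_sum A k)%:R).
Proof.
move=> kN; rewrite -size_sum_edges.
apply: le_trans (_ : Ex (fun A =>
  (indep (sum_edges N k) A)%:R * (inord k./2 \notin A)%:R) <= _).
  apply: le_trans (Ex_nmem_ge q01 (inord k./2) (@indep_decreasing R _ (sum_edges N k))).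
  apply: ler_wpM2l; first by case/andP: q01 => _ /ltW; rewrite subr_ge0.
  apply: Ex_indep_ge => //; apply/allP => e; rewrite mem_sum_edges //.
  by move=> /andP[+ _]; apply: contraTneq => ->; rewrite ltnn.
apply: Ex_le => // A; rewrite -natrM mulnb ler_nat.
by case: (boolP (_ && _)) => // /andP[h1 h2]; rewrite (nhas_sum kN h1 h2).
Qed.

Lemma Ex_nhas_diff_le d : (0 < d)%N ->
  Ex (fun A => (~~ has_diff A d)%:R) <= rho ^+ (N.+1 - d).
Proof.
move=> d0; rewrite -size_diff_edges.
apply: le_trans (@diff_indep_le d d _ (uniq_diff_edges N d) _).
  by apply: Ex_le => // A; rewrite nhas_diff.
by move=> e; rewrite mem_diff_edges => /eqP <-; rewrite eqxx -addn1 leq_add2l.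
Qed.

Lemma Ex_nhas_diff2_le k l : (0 < k)%N -> (0 < l)%N -> k != l ->
  Ex (fun A => (~~ has_diff A k)%:R * (~~ has_diff A l)%:R)
    <= rho ^+ (N.+1 - k) * rho ^+ (N.+1 - l).
Proof.
move=> k0 l0 kl; rewrite -exprD -!size_diff_edges -size_cat.
apply: le_trans (@diff_indep_le k l _ _ _).
- by apply: Ex_le => // A; rewrite -natrM mulnb ler_nat indep_cat !nhas_diff.
- apply: (@uniq_cat_edges (fun e => e.1 + k == e.2)%N (fun e => e.1 + l == e.2)%N).
  + exact: uniq_diff_edges.
  + exact: uniq_diff_edges.
  + by move=> e; rewrite mem_diff_edges.
  + by move=> e; rewrite mem_diff_edges.
  + by move=> e /eqP <-; rewrite eqn_add2l eq_sym.
- move=> e; rewrite mem_cat !mem_diff_edges => /orP[] h; rewrite h ?orbT;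
    by rewrite -(eqP h) -addn1 leq_add2l.
Qed.

Lemma Ex_nhas_diff_ge d : (0 < d)%N ->
  (1 - q ^+ 2) ^+ (N.+1 - d) <= Ex (fun A => (~~ has_diff A d)%:R).
Proof.
move=> d0; rewrite -size_diff_edges; under eq_Ex do rewrite nhas_diff.
apply: Ex_indep_ge => //; apply/allP => e; rewrite mem_diff_edges => /eqP ed.
by apply: contraTneq d0 => e12; rewrite -leqNgt -(leq_add2l e.1) ed addn0 e12.
Qed.

End Probabilities.

(** * Geometric sums *)

Section GeometricSums.
Variable R : realType.
Implicit Types (r s t : R) (M N : nat).

(** For [s != 0] this is [(1 - (1 - s) ^+ M) / s]; for [0 < s <= 1] its order of magnitude is the
    smaller of [M] and [1 / s]. *)
Definition geo s M : R := \sum_(i < M) (1 - s) ^+ i.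

Lemma geoS s M : geo s M.+1 = geo s M + (1 - s) ^+ M.
Proof. by rewrite /geo big_ord_recr. Qed.

Lemma mul_geo s M : s * geo s M = 1 - (1 - s) ^+ M.
Proof.
elim: M => [|M IH]; first by rewrite /geo big_ord0 mulr0 expr0 subrr.
by rewrite geoS mulrDr IH exprS; ring.
Qed.

Lemma geo_ge0 s M : s <= 1 -> 0 <= geo s M.
Proof. by move=> s1; apply: sumr_ge0 => i _; rewrite exprn_ge0 // subr_ge0. Qed.

(** Induction, since [(1 - s) * (1 + s * (M + 1))] equals [1 + s * M - s ^+ 2 * (M + 1)]. It gives
    decay of the power without exponentials. *)
Lemma exprB1_le s M : 0 <= s <= 1 -> (1 - s) ^+ M * (1 + s * M%:R) <= 1.
Proof.
move=> /andP[s0 s1]; elim: M => [|M IH]; first by rewrite expr0 mulr0; lra.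
apply: le_trans IH; rewrite exprS -mulrA mulrCA ler_wpM2l ?exprn_ge0 ?subr_ge0 //.
have M0 : 0 <= M%:R :> R by [].
rewrite -natr1; have : 0 <= s ^+ 2 * (M%:R + 1) by rewrite mulr_ge0 ?exprn_ge0 ?addr_ge0.
nra.
Qed.

Lemma geo_ge s M : 0 < s <= 1 -> M%:R <= geo s M * (1 + s * M%:R).
Proof.
move=> /andP[s0 s1]; rewrite -(ler_pM2l s0) mulrA mul_geo mulrBl mul1r.
have := @exprB1_le s M; rewrite (ltW s0) s1 => /(_ isT); lra.
Qed.

(** Used with [s = q ^+ 2] and [t = (1 - q) ^+ 8]: passing from the rate in [rho] to [q ^+ 2] costs
    only the factor [t], which is close to 1. *)
Lemma geo_mul_le s t M : 0 < s <= 1 -> 0 < t <= 1 -> geo (s * t) M * t <= geo s M.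
Proof.
move=> /andP[s0 s1] /andP[t0 t1].
rewrite -(ler_pM2l s0) [_ * t]mulrC mulrA !mul_geo lerD2l lerN2 lerXn2r ?nnegrE ?subr_ge0 //; first by nra.
by rewrite lerD2l lerN2 ler_piMr // ltW.
Qed.

Lemma geo_double s M : geo s (M + M) = geo s M * (1 + (1 - s) ^+ M).
Proof.
rewrite /geo big_split_ord /= mulrDr mulr1; congr (_ + _).
by rewrite mulr_suml; apply: eq_bigr => i _; rewrite exprD mulrC.
Qed.

(** [halfgap] is symmetric under [k |-> 2 * N - k]; the second sum is the reflected half. *)
Lemma sum_halfgap (f : nat -> R) N :
  \sum_(k < (2 * N).+1) f (halfgap N k) =
  \sum_(k < N.+1) f k.+1./2 + \sum_(k < N) f k.+1./2.
Proof.
rewrite (_ : (2 * N).+1 = N.+1 + N)%N; last by lia.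
rewrite big_split_ord /=; congr (_ + _).
  by apply: eq_bigr => k _; congr f; have := ltn_ord k; rewrite /halfgap; lia.
rewrite [RHS](reindex_inj rev_ord_inj) /=; apply: eq_bigr => k _; congr f.
by have := ltn_ord k; rewrite /halfgap; lia.
Qed.

(** Every two-element subset of the interval has exactly one sum, so the total is a binomial
    coefficient. *)
Lemma sum_halfgap_nat N :
  \sum_(k < (2 * N).+1) (halfgap N k)%:R = N%:R * N.+1%:R / 2 :> R.
Proof.
rewrite (sum_halfgap (fun n => n%:R)); elim: N => [|N IH].
  by rewrite big_ord_recr !big_ord0 /= !mul0r !addr0.
rewrite big_ord_recr /= [X in _ + X]big_ord_recr /= addrACA IH -natrD.
rewrite (_ : N.+2./2 + N.+1./2 = N.+1)%N; last by lia.
by rewrite -![_.+2%:R]natr1 -![_.+1%:R]natr1; field.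
Qed.

Lemma sum_half r n : \sum_(k < n.*2) r ^+ k./2 = 2 * geo (1 - r) n.
Proof.
elim: n => [|n IH]; first by rewrite /geo !big_ord0 mulr0.
rewrite doubleS 2!big_ord_recr /= IH geoS uphalf_double doubleK subKr; ring.
Qed.

(** Each exponent occurs four times except at the ends of the range, and the exceptions contribute
    at most 4 for either parity of [N]. *)
Lemma sum_halfgap_expr r N : 0 <= r <= 1 ->
  4 * geo (1 - r) N./2 - 4 <= \sum_(k < (2 * N).+1) r ^+ halfgap N k
    <= 4 * geo (1 - r) N./2 + 4.
Proof.
move=> r01; rewrite (sum_halfgap (fun n => r ^+ n)).
have sh n : \sum_(k < n) r ^+ k.+1./2 = \sum_(k < n.+1) r ^+ k./2 - 1.
  by rewrite big_ord_recl expr0 addrC addKr.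
rewrite !sh; set M := N./2; have rM n : 0 <= r ^+ n <= 1.
  by case/andP: r01 => *; rewrite exprn_ge0 ?exprn_ile1.
have : N = M.*2 \/ N = M.*2.+1 by rewrite /M; lia.
case=> ->; rewrite !big_ord_recr /= sum_half ?uphalf_double ?doubleK;
  have := rM M; have := rM M.+1; lra.
Qed.

(** The hypotheses give [1 <= e ^+ 2 * N], while [geo_ge] bounds the sum below by
    [M / (1 + q ^+ 2 * M)] with [q <= e]. The condition relating [N] to [M] admits both [M = N] and
    [M = N./2]. *)
Lemma geo_large (e q : R) M N : 0 < e <= 1 / 100 -> 0 < q < 1 ->
  1 <= e * (N%:R * q) -> q <= e -> N%:R <= 3 * M%:R + 2 :> R ->
  1 <= e * geo (q ^+ 2) M.
Proof.
move=> /andP[e0 e1] /andP[q0 q1] Nq qe NM.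
have M0 : 0 <= M%:R :> R by [].
have N0 : 0 <= N%:R :> R by [].
have h1 : 1 <= e ^+ 2 * N%:R.
  by apply: le_trans Nq _; rewrite expr2 -mulrA ler_pM2l // mulrC ler_wpM2r.
have q2 : 0 < q ^+ 2 <= 1 by rewrite exprn_gt0 //= exprn_ile1 // ltW.
have q2M : q ^+ 2 * M%:R <= e ^+ 2 * M%:R.
  by rewrite ler_wpM2r // lerXn2r // nnegrE ltW.
have e2 : e ^+ 2 <= e / 100 by rewrite expr2; nra.
have p : 0 < 1 + q ^+ 2 * M%:R.
  by rewrite ltr_pwDl // mulr_ge0 // ltW //; case/andP: q2.
rewrite -(ler_pM2r p) mul1r -(mulrA e).
apply: (@le_trans _ _ (e * M%:R)); last by rewrite ler_pM2l // geo_ge.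
have : e ^+ 2 * N%:R <= e ^+ 2 * (3 * M%:R + 2) by rewrite ler_pM2l // exprn_gt0.
have : e ^+ 2 * M%:R <= e / 100 * M%:R by rewrite ler_wpM2r.
have : e / 100 * M%:R = (e * M%:R) / 100 by ring.
have : e / 100 <= 1 / 10000 by lra.
nra.
Qed.

Lemma theta_ge (q e : R) : 0 < q < 1 -> q <= e -> 1 - 8 * e <= (1 - q) ^+ 8.
Proof.
move=> /andP[q0 q1] qe; apply: (@le_trans _ _ (1 - 8 * q)); first by lra.
have h n : 1 - n%:R * q <= (1 - q) ^+ n.
  elim: n => [|n IH]; first by rewrite mul0r subr0 expr0.
  rewrite exprS; apply: le_trans (ler_wpM2l _ IH); last by lra.
  have n0 : 0 <= n%:R :> R by []. rewrite -natr1.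
  have : 0 <= n%:R * (q * q) by rewrite mulr_ge0 // mulr_ge0 // ltW.
  lra.
exact: h.
Qed.

End GeometricSums.

(** * Second moment about an approximate mean *)

Section SecondMoment.
Variables (R : realType) (T : finType) (q e : R).
Hypotheses (q01 : 0 < q < 1) (e01 : 0 < e <= 1 / 100) (qe : q <= e).
Local Notation Ex := (@Ex R T q).

(** With [G = c * F], the bounds on [b] and on [Ex W] put both within a factor [1 + O(e)] of [G], so
    the main terms of [Ex W^2 - 2 G Ex W + G^2] cancel. Additive errors of size [c] are absorbed by
    [1 <= e * F]. *)
Lemma second_moment_le (W : {set T} -> R) (c F b : R) :
    1 <= c <= 4 -> 1 <= e * F -> 0 <= b ->
    b * (1 - q) ^+ 8 <= c * F + c * (1 - q) ^+ 8 ->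
    (1 - q) * (c * F - c) <= Ex W -> Ex (fun A => W A ^+ 2) <= b ^+ 2 + b ->
  Ex (fun A => (W A - c * F) ^+ 2) <= 2000 * e * F ^+ 2.
Proof.
move=> /andP[c1 c4] eF b0 bth EW EW2.
case/andP: (q01) => q0 q1; case/andP: (e01) => e0 e1.
have F0 : 0 < F by rewrite -(pmulr_rgt0 _ e0); lra.
have -> : Ex (fun A => (W A - c * F) ^+ 2) =
    Ex (fun A => W A ^+ 2) - 2 * c * F * Ex W + (c * F) ^+ 2.
  transitivity (Ex (fun A => (W A ^+ 2 - 2 * c * F * W A) + (c * F) ^+ 2)).
    by apply: eq_Ex => A; ring.
  by rewrite ExD ExB ExZ Ex_const.
have th := theta_ge q01 qe; have th1 : (1 - q) ^+ 8 <= 1.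
  by apply: exprn_ile1; lra.
set t := (1 - q) ^+ 8 in th th1 bth; set G := c * F in bth EW *.
have G0 : 0 < G by rewrite mulr_gt0 //; lra.
have cG : c <= e * G by rewrite /G mulrCA ler_peMr //; lra.
(* For [e <= 1 / 100], [1 + e] is at most [(1 - 8 * e) * (1 + 17 * e)]. *)
have bG : b <= G * (1 + 17 * e).
  have bt : b * (1 - 8 * e) <= b * t by rewrite ler_wpM2l.
  have ct : c * t <= e * G by apply: le_trans cG; rewrite ler_piMr //; lra.
  have p : 0 < 1 - 8 * e by lra.
  rewrite -(ler_pM2r p); apply: (@le_trans _ _ (G * (1 + e))); first by lra.
  by rewrite -(mulrA G) ler_pM2l //; nra.
have b2 : b ^+ 2 <= G ^+ 2 * (1 + 40 * e).
  apply: (@le_trans _ _ ((G * (1 + 17 * e)) ^+ 2)).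
    by rewrite lerXn2r // nnegrE mulr_ge0 ?ltW //; lra.
  by rewrite exprMn ler_pM2l ?exprn_gt0 //; nra.
have G1 : 1 <= e * G by apply: le_trans cG.
have bb : b <= 2 * e * G ^+ 2.
  apply: (@le_trans _ _ (2 * G)); last by rewrite expr2; nra.
  by apply: le_trans bG _; nra.
have EG : (1 - 2 * e) * G <= Ex W.
  apply: le_trans EW; apply: (@le_trans _ _ ((1 - e) * (G - e * G))).
    have : 0 <= e ^+ 2 * G by rewrite mulr_ge0 ?exprn_ge0 ?ltW.
    by lra.
  apply: ler_pM; [by lra| |by move: qe; lra|by lra].
  by rewrite -[X in X - _]mul1r -mulrBl mulr_ge0 ?ltW //; lra.
have EG2 : (1 - 2 * e) * G ^+ 2 <= G * Ex W.
  by rewrite expr2 mulrCA ler_pM2l.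
have GF : G ^+ 2 <= 16 * F ^+ 2.
  rewrite /G exprMn ler_pM2r ?exprn_gt0 //.
  by rewrite (_ : 16 = 4 ^+ 2); [rewrite lerXn2r // nnegrE; lra|ring].
have eGF : e * G ^+ 2 <= e * (16 * F ^+ 2) by rewrite ler_pM2l.
rewrite -!mulrA (mulrA c F) -/G.
have : 0 <= e * F ^+ 2 by rewrite mulr_ge0 ?exprn_ge0 ?ltW.
lra.
Qed.

End SecondMoment.

(** * Missing sums and differences *)

Section Counting.
Variables (R : realType) (N : nat).
Implicit Types A : {set 'I_N.+1}.

Lemma binomial_modelE (q : R) (E : pred {set 'I_N.+1}) :
  binomial_model q E = Ex q (fun A => (E A)%:R).
Proof.
rewrite /binomial_model big_mkcond; apply: eq_bigr => A _.
by case: (E A); rewrite ?mulr1 ?mulr0.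
Qed.

Lemma binomial_markov (q : R) (f : {set 'I_N.+1} -> R) (b : pred {set 'I_N.+1})
    (t c : R) : 0 < q < 1 -> 0 < t -> (forall A, 0 <= f A) ->
    (forall A, b A -> t <= f A) -> Ex q f <= c * t ->
  binomial_model q b <= c.
Proof.
move=> q01 t0 f0 bf Ef; rewrite binomial_modelE.
by apply: le_trans (Ex_markov q01 t0 f0 bf) _; rewrite ler_pdivrMr.
Qed.

Lemma natr_negb (b : bool) : (~~ b)%:R = 1 - b%:R :> R.
Proof. by case: b; rewrite ?subrr ?subr0. Qed.

Lemma missing_sumsE A :
  missing_sums R A = \sum_(k < (2 * N).+1) (~~ has_sum A k)%:R.
Proof.
rewrite /missing_sums /card_sumset card_sumsetE natr_sum.
under [RHS]eq_bigr do rewrite natr_negb.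
by rewrite sumrB sumr_const card_ord addn1.
Qed.

Lemma missing_diffsE A :
  missing_diffs R A =
  2 * (\sum_(d < N) (~~ has_diff A d.+1)%:R) + (~~ has_diff A 0)%:R.
Proof.
rewrite /missing_diffs /card_diffset card_diffsetE -muln2 2!natrD 2!natrM natr_sum.
under [in RHS]eq_bigr do rewrite natr_negb.
rewrite sumrB sumr_const card_ord natr_negb; ring.
Qed.

Lemma card_pairs_le (m : nat) (P : pred 'I_m) (S : {set 'I_N.+1 * 'I_N.+1})
    (h : 'I_N.+1 * 'I_N.+1 -> 'I_m) :
  (forall k, P k -> exists2 e, e \in S & h e = k) -> (\sum_k P k <= #|S|)%N.
Proof.
move=> PS; rewrite -(big_mkcond P (fun=> 1)%N) sum1_card.
apply: leq_trans (leq_imset_card h S); apply/subset_leq_card/fintype.subsetP => k /PS[e eS <-].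
exact: imset_f.
Qed.

(** Sums come from pairs with [e.1 <= e.2]. These and their mirror images cover the square of [A]
    and overlap in the diagonal, which gives the count. *)
Lemma card_sumset_le A : 2 * card_sumset R A <= #|A|%:R ^+ 2 + #|A|%:R.
Proof.
rewrite /card_sumset card_sumsetE -natrX -natrM -natrD ler_nat.
pose S1 := [set e : 'I_N.+1 * 'I_N.+1 in finset.setX A A | (e.1 <= e.2)%N]%SET.
pose S2 := [set e : 'I_N.+1 * 'I_N.+1 in finset.setX A A | (e.2 <= e.1)%N]%SET.
have swI : injective (fun e : 'I_N.+1 * 'I_N.+1 => (e.2, e.1)) by move=> [a b] [c d] [-> ->].
have S12 : #|S2| = #|S1|.
  rewrite -(card_imset _ swI); apply: eq_card => -[a b]; rewrite !inE /=.
  apply/imsetP/andP => [[[c d]]|[/andP[aA bA] ab]].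
    by rewrite !inE /= => h [-> ->]; move: h => /andP[/andP[-> ->] ->].
  by exists (b, a); rewrite // !inE /= aA bA.
have SU : (S1 :|: S2)%SET = finset.setX A A.
  apply/finset.setP => -[a b]; rewrite !inE /=.
  by case: (a \in A); case: (b \in A) => //=; exact: leq_total.
have SI : #|(S1 :&: S2)%SET| = #|A|.
  rewrite -(card_imset (mem A) (f := fun a => (a, a))); last by move=> a b [].
  apply: eq_card => -[a b]; rewrite !inE /=; apply/idP/imsetP => [|[c cA [-> ->]]].
    move=> /andP[/andP[/andP[aA bA] ab] /andP[_ ba]]; exists a => //.
    by congr pair; apply: val_inj => /=; lia.
  by rewrite !leqnn !andbT !andbb; exact: cA.
have := cardsUI S1 S2; rewrite SU SI finset.cardsX S12 => E.
rewrite (_ : #|A| ^ 2 + #|A| = 2 * #|S1|)%N; last by rewrite -mulnn E addnn mul2n.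
rewrite leq_pmul2l // (@card_pairs_le _ _ S1 (fun e => inord (e.1 + e.2))) // => k.
move=> /has_sumP[i [j [iA jA ijk]]]; case: (leqP i j) => ij.
  exists (i, j); rewrite ?inE /= ?iA ?jA //.
  by apply: val_inj; rewrite /= inordK ijk.
exists (j, i); rewrite ?inE /= ?iA ?jA ?(ltnW ij) //.
by apply: val_inj; rewrite /= inordK addnC ijk.
Qed.

Lemma card_diffset_le A : card_diffset R A <= #|A|%:R ^+ 2.
Proof.
rewrite /card_diffset -natrX ler_nat -mulnn -finset.cardsX cardE.
pose D := [fset (nat_of_ord e.1)%:Z - (nat_of_ord e.2)%:Z | e in finset.setX A A]%fset.
apply: (@leq_trans #|` D|); last exact: leq_imfset_card.
apply/fsubset_leq_card/fsubsetP => z /imfset2P[/= _ /mem_to_intsP[i iA ->]].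
move=> [_ /mem_to_intsP[j jA ->] ->]; apply/imfsetP => /=; exists (i, j) => //.
by rewrite !inE iA jA.
Qed.

End Counting.

(** * Concentration of the numbers of missing sums and differences *)

Section Dense.
Variables (R : realType) (N : nat) (q e : R).
Hypotheses (q01 : 0 < q < 1) (e01 : 0 < e <= 1 / 100).
Hypotheses (Nq : 1 <= e * (N%:R * q)) (qe : q <= e).
Local Notation Ex := (@Ex R 'I_N.+1 q).
Local Notation th := ((1 - q) ^+ 8).
Local Notation rho := (1 - q ^+ 2 * th).

Lemma geo_half_large : 1 <= e * geo (q ^+ 2) N./2.
Proof.
apply: (geo_large e01 q01 Nq qe).
have : (N <= 3 * N./2 + 2)%N by lia.
by rewrite -(ler_nat R) natrD natrM.
Qed.

Lemma geo_full_large : 1 <= e * geo (q ^+ 2) N.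
Proof.
apply: (geo_large e01 q01 Nq qe).
have : (N <= 3 * N + 2)%N by lia.
by rewrite -(ler_nat R) natrD natrM.
Qed.

Lemma q2_bounds : 0 < q ^+ 2 <= 1.
Proof. by case/andP: q01 => q0 q1; rewrite exprn_gt0 // exprn_ile1 // ltW. Qed.

Lemma th_bounds : 0 < th <= 1.
Proof.
case/andP: q01 => q0 q1; rewrite exprn_gt0 ?subr_gt0 // exprn_ile1 //;
  by [rewrite subr_ge0 ltW|rewrite gerBl ltW].
Qed.

Lemma rho_bounds : 0 <= rho <= 1.
Proof.
have := q2_bounds; have := th_bounds; move: (q ^+ 2) th => a b.
by move=> /andP[b0 b1] /andP[a0 a1]; nra.
Qed.

Lemma Ex_nhas_sum_sqr k : (k <= 2 * N)%N ->
  Ex (fun A => (~~ has_sum A k)%:R ^+ 2) <= rho ^+ halfgap N k.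
Proof.
move=> kN; apply: le_trans (Ex_nhas_sum_le q01 kN); apply: Ex_le => // A.
by case: (~~ _); rewrite ?expr1n ?expr0n.
Qed.

Lemma Ex_nhas_diff_sqr d :
  Ex (fun A => (~~ has_diff A d.+1)%:R ^+ 2) <= rho ^+ (N.+1 - d.+1).
Proof.
apply: (@le_trans _ _ (Ex (fun A => (~~ has_diff A d.+1)%:R))).
  by apply: Ex_le => // A; case: (~~ _); rewrite ?expr1n ?expr0n.
exact: Ex_nhas_diff_le.
Qed.

Lemma missing_sums_moment :
  Ex (fun A => (missing_sums R A - 4 * geo (q ^+ 2) N./2) ^+ 2)
    <= 2000 * e * geo (q ^+ 2) N./2 ^+ 2.
Proof.
case/andP: (q01) => q0 q1; case/andP: rho_bounds => r0 r1.
have /andP[t0 t1] := th_bounds; have /andP[s0 s1] := q2_bounds.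
have kN (k : 'I_(2 * N).+1) : (k <= 2 * N)%N by rewrite -ltnS ltn_ord.
apply: (@second_moment_le _ _ _ _ q01 e01 qe _ _ _
  (\sum_(k < (2 * N).+1) rho ^+ halfgap N k)).
- by lra.
- exact: geo_half_large.
- by apply: sumr_ge0 => k _; rewrite exprn_ge0.
- have /andP[_] := sum_halfgap_expr N rho_bounds; rewrite subKr => h.
  apply: le_trans (ler_wpM2r (ltW t0) h) _.
  rewrite mulrDl -mulrA lerD2r ler_pM2l // geo_mul_le //; exact/andP.
- have /andP[h _] := @sum_halfgap_expr _ (1 - q ^+ 2) N ltac:(lra).
  rewrite subKr in h; apply: le_trans (ler_wpM2l _ h) _; first by lra.
  under eq_Ex do rewrite missing_sumsE.
  rewrite Ex_sum mulr_sumr; apply: ler_sum => k _; exact: Ex_nhas_sum_ge.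
- under eq_Ex do rewrite missing_sumsE.
  apply: Ex_sqr_sum_le => [k|k|k l kl]; first by rewrite exprn_ge0.
    exact: Ex_nhas_sum_sqr.
  exact: Ex_nhas_sum2_le.
Qed.

Lemma missing_diffs_moment :
  Ex (fun A => ((\sum_(d < N) (~~ has_diff A d.+1)%:R) - 1 * geo (q ^+ 2) N) ^+ 2)
    <= 2000 * e * geo (q ^+ 2) N ^+ 2.
Proof.
case/andP: (q01) => q0 q1; case/andP: rho_bounds => r0 r1.
have /andP[t0 t1] := th_bounds; have /andP[s0 s1] := q2_bounds.
(* The exponents run from [N] down to 1, whereas [geo] uses 0 to [N - 1]; hence the correction
   [r ^+ N - 1]. *)
have geo_rev r : \sum_(d < N) r ^+ (N.+1 - d.+1) = geo (1 - r) N + r ^+ N - 1.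
  rewrite (reindex_inj rev_ord_inj) /=.
  under eq_bigr => d _ do rewrite subSS subKn //.
  apply: (addIr 1); rewrite subrK addrC -[in LHS](expr0 r).
  by rewrite -(big_ord_recl N (fun i : 'I_N.+1 => r ^+ i)) big_ord_recr /geo subKr.
apply: (@second_moment_le _ _ _ _ q01 e01 qe _ _ _
  (\sum_(d < N) rho ^+ (N.+1 - d.+1))).
- by lra.
- exact: geo_full_large.
- by apply: sumr_ge0 => k _; rewrite exprn_ge0.
- rewrite geo_rev subKr.
  have := geo_mul_le N q2_bounds th_bounds; have : rho ^+ N <= 1 by rewrite exprn_ile1.
  nra.
- apply: (@le_trans _ _ (geo (q ^+ 2) N - 1)).
    rewrite mul1r ler_piMl //; last by lra.
    case: (N) Nq => [|n _]; first by rewrite mul0r mulr0 ler10.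
    rewrite /geo big_ord_recl expr0 addrC addKr sumr_ge0 // => i _.
    by rewrite exprn_ge0 // subr_ge0.
  apply: (@le_trans _ _ (\sum_(d < N) (1 - q ^+ 2) ^+ (N.+1 - d.+1))).
    rewrite geo_rev subKr; have : 0 <= (1 - q ^+ 2) ^+ N by rewrite exprn_ge0 // subr_ge0.
    by lra.
  by rewrite Ex_sum; apply: ler_sum => d _; apply: Ex_nhas_diff_ge.
- apply: Ex_sqr_sum_le => [k|k|k l kl]; first by rewrite exprn_ge0.
    exact: Ex_nhas_diff_sqr.
  exact: Ex_nhas_diff2_le.
Qed.

Lemma missing_sums_conc (d : R) : 0 < d ->
  binomial_model q (fun A : {set 'I_N.+1} =>
    ~~ (`|missing_sums R A - 4 * geo (q ^+ 2) N./2| <= d * geo (q ^+ 2) N./2))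
  <= 2000 * e / d ^+ 2.
Proof.
move=> d0; have Fe : 1 <= e * geo (q ^+ 2) N./2 by exact: geo_half_large.
have F0 : 0 < geo (q ^+ 2) N./2.
  by case/andP: (e01) => e0 _; rewrite -(pmulr_rgt0 _ e0); lra.
set F := geo _ _ in F0 Fe *.
have dF : 0 < (d * F) ^+ 2 by rewrite exprn_gt0 // mulr_gt0.
apply: (binomial_markov (f := fun A => (missing_sums R A - 4 * F) ^+ 2) q01 dF).
- by move=> A; exact: sqr_ge0.
- move=> A; rewrite -ltNge => /ltW h.
  by rewrite /= -[leRHS](real_normK (num_real _)) lerXn2r // nnegrE mulr_ge0 // ltW.
apply: le_trans missing_sums_moment _.
by rewrite -/F le_eqVlt; apply/orP; left; apply/eqP; field; exact: lt0r_neq0.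
Qed.

Lemma missing_diffs_conc (d : R) : 0 < d -> 2 * e <= d ->
  binomial_model q (fun A : {set 'I_N.+1} =>
    ~~ (`|missing_diffs R A - 2 * geo (q ^+ 2) N| <= d * geo (q ^+ 2) N))
  <= 16 * (2000 * e) / d ^+ 2.
Proof.
move=> d0 ed; have Fe : 1 <= e * geo (q ^+ 2) N by exact: geo_full_large.
have F0 : 0 < geo (q ^+ 2) N.
  by case/andP: (e01) => e0 _; rewrite -(pmulr_rgt0 _ e0); lra.
set F := geo _ _ in F0 Fe *.
(* The deviation is [2 * (W - F)] plus the indicator that 0 is missing, at most 1. Since
   [2 <= d * F], a bad set has [W] off by at least [d / 4 * F]. *)
have dF : 0 < (d / 4 * F) ^+ 2 by rewrite exprn_gt0 // mulr_gt0 // divr_gt0.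
apply: (binomial_markov
  (f := fun A => ((\sum_(d < N) (~~ has_diff A d.+1)%:R) - 1 * F) ^+ 2) q01 dF).
- by move=> A; exact: sqr_ge0.
- move=> A; rewrite -ltNge missing_diffsE mul1r; set W := \sum_(_ < _) _.
  set z := (~~ _)%:R => h.
  rewrite -[leRHS](real_normK (num_real _)) lerXn2r // ?nnegrE ?mulr_ge0 ?divr_ge0 // ?ltW //.
  have z1 : 0 <= z <= 1 by rewrite /z ler0n lern1 leq_b1.
  have dF2 : 2 <= d * F.
    have : 2 * e * F <= d * F by rewrite ler_pM2r.
    by lra.
  have := ler_norm (W - F); have := ler_norm (- (W - F)); rewrite normrN.
  by move: h; rewrite ltr_normr => /orP[]; lra.
apply: le_trans missing_diffs_moment _.
rewrite -/F le_eqVlt; apply/orP; left; apply/eqP; field; exact: lt0r_neq0.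
Qed.

End Dense.

(** * Sparse sets *)

Section Sparse.
Variables (R : realType) (N : nat) (q e : R).
Hypotheses (q01 : 0 < q < 1) (e01 : 0 < e <= 1 / 100).
Hypotheses (Nq : 1 <= e * (N%:R * q)) (qe : q <= e) (Nq2 : N%:R * q ^+ 2 <= e).
Local Notation Ex := (@Ex R 'I_N.+1 q).
Local Notation th := ((1 - q) ^+ 8).
Local Notation rho := (1 - q ^+ 2 * th).
Local Notation mu := (N%:R * q).
Implicit Type A : {set 'I_N.+1}.

Lemma natr_card A : #|A|%:R = \sum_i (i \in A)%:R :> R.
Proof. by rewrite -sum1_card natr_sum big_mkcond; apply: eq_bigr => i _; case: (i \in A). Qed.

Lemma Ex_in (i : 'I_N.+1) : Ex (fun A => (i \in A)%:R) = q.
Proof.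
transitivity (Ex (fun A => 1 * (i \in A)%:R)).
  by apply: eq_Ex => A; rewrite mul1r.
by rewrite (Ex_mem q i (fun=> 1)) Ex_const mulr1.
Qed.

Lemma Ex_card : Ex (fun A => #|A|%:R) = mu + q.
Proof.
under eq_Ex do rewrite natr_card.
rewrite Ex_sum (eq_bigr (fun=> q)) => [|i _].
  by rewrite sumr_const card_ord -[LHS]mulr_natl -natr1 mulrDl mul1r.
exact: Ex_in.
Qed.

Lemma Ex_card_sqr : Ex (fun A => #|A|%:R ^+ 2) <= (mu + q) ^+ 2 + (mu + q).
Proof.
case/andP: (q01) => q0 q1.
have -> : mu + q = \sum_(i < N.+1) q.
  by rewrite sumr_const card_ord -[RHS]mulr_natl -natr1 mulrDl mul1r.
under eq_Ex do rewrite natr_card.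
apply: (Ex_sqr_sum_le (Z := fun i A => (i \in A)%:R)) => [i|i|i j ij]; first exact: ltW.
  rewrite -[leRHS](Ex_in i); apply: Ex_le => // A.
  by case: (_ \in _); rewrite ?expr1n ?expr0n.
rewrite Ex_mem ler_pM2l // -[leRHS](Ex_in i); apply: Ex_le => // A.
by rewrite !inE (negbTE ij).
Qed.

(** [Y] never exceeds [X ^+ 2 + X] with [X] the size of [A], yet its mean nearly reaches that of
    this bound. So the defect is small on average, and [X] is close to [mu] by its variance. *)
Lemma sparse_conc (Y : {set 'I_N.+1} -> R) (d : R) : 0 < d ->
    (forall A, Y A <= #|A|%:R ^+ 2 + #|A|%:R) -> (1 - 9 * e) * mu ^+ 2 <= Ex Y ->
  binomial_model q (fun A => ~~ (`|Y A - mu ^+ 2| <= d * mu ^+ 2))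
    <= 42 * (1 + 2 / d) * e / d.
Proof.
move=> d0 YX EY; case/andP: (q01) => q0 q1; case/andP: (e01) => e0 e1.
have mu0 : 0 < mu by rewrite -(pmulr_rgt0 _ e0); move: Nq; lra.
have mu2 : 0 < mu ^+ 2 by rewrite exprn_gt0.
have emu : mu <= e * mu ^+ 2 by rewrite expr2 mulrA ler_peMl // ltW.
have mu1 : 1 <= mu by move: Nq; nra.
have t0 : 0 < d / 2 * mu ^+ 2 by rewrite mulr_gt0 // divr_gt0.
have D0 : 0 <= 2 / d by rewrite divr_ge0 // ltW.
pose X A : R := #|A|%:R.
(* A nonnegative quantity that bounds the deviation of [Y] from [mu ^+ 2] up to [d / 2 * mu ^+ 2];
   Markov's inequality is applied to it. *)
pose V A := (1 + 2 / d) * (X A - mu) ^+ 2 + X A + (X A ^+ 2 + X A - Y A).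
have V0 A : 0 <= V A.
  have := YX A; have : 0 <= X A by [].
  have : 0 <= (1 + 2 / d) * (X A - mu) ^+ 2 by rewrite mulr_ge0 ?sqr_ge0 ?addr_ge0.
  by rewrite /V /X; lra.
apply: (binomial_markov q01 t0 V0).
  move=> A; rewrite -ltNge => bad.
  (* AM-GM: [2 mu |X - mu| <= (d / 2) mu^2 + (2 / d) (X - mu)^2] *)
  have amgm : `|X A ^+ 2 - mu ^+ 2| <= d / 2 * mu ^+ 2 + (1 + 2 / d) * (X A - mu) ^+ 2.
    set x := X A - mu; have -> : X A ^+ 2 - mu ^+ 2 = x ^+ 2 + 2 * x * mu by rewrite /x; ring.
    (* A completed square in disguise: the last term vanishes at [s = 1] and [s = -1], which yield
       the two signs. *)
    have sq s : 0 <= d / 2 * mu ^+ 2 + 2 / d * x ^+ 2 + s * (2 * x * mu) +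
        (s ^+ 2 - 1) * (2 / d * x ^+ 2).
      rewrite (_ : _ + _ = d / 2 * (mu + s * (2 / d) * x) ^+ 2); last first.
        by field; exact: lt0r_neq0.
      by rewrite mulr_ge0 ?sqr_ge0 // divr_ge0 // ltW.
    have := sq 1; have := sq (-1); have := sqr_ge0 x.
    by rewrite ler_norml; move=> *; apply/andP; split; nra.
  have X0 : 0 <= X A by [].
  move: bad amgm (YX A); rewrite /V -/(X A); move: ((1 + 2 / d) * _) => w.
  rewrite ler_norml ltr_normr => bad /andP[a1 a2] yx.
  by case/orP: bad; lra.
(* The 21 is 3 from the variance bound [b1] plus 18 from the size and the defect in [b2]. *)
rewrite [leRHS](_ : _ = (1 + 2 / d) * (21 * (e * mu ^+ 2))); last first.
  by field; exact: lt0r_neq0.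
have -> : Ex V = (1 + 2 / d) * (Ex (fun A => X A ^+ 2) - 2 * mu * Ex X + mu ^+ 2) +
    Ex X + (Ex (fun A => X A ^+ 2) + Ex X - Ex Y).
  have -> : Ex (fun A => X A ^+ 2) - 2 * mu * Ex X + mu ^+ 2 =
      Ex (fun A => (X A - mu) ^+ 2).
    rewrite -ExZ -ExB -{1}(Ex_const 'I_N.+1 q (mu ^+ 2)) -ExD.
    by apply: eq_Ex => A; ring.
  by rewrite -ExZ -!ExD -ExB -ExD; apply: eq_Ex.
have hE2 : Ex (fun A => X A ^+ 2) <= (mu + q) ^+ 2 + (mu + q) := Ex_card_sqr.
have hE1 : Ex X = mu + q := Ex_card.
move: (Ex (fun A => X A ^+ 2)) (Ex X) (Ex Y) hE1 hE2 EY => E2 E1 EY -> hE2 hEY.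
have qq := qe; have q2 : q ^+ 2 <= 1 / 100 by rewrite expr2; nra.
have qmu : q * mu <= mu / 100 by rewrite [leRHS]mulrC ler_pM2r //; lra.
have msq : (mu + q) ^+ 2 = mu ^+ 2 + 2 * (q * mu) + q ^+ 2 by ring.
have msq' : 2 * mu * (mu + q) = 2 * mu ^+ 2 + 2 * (q * mu) by ring.
have b1 : E2 - 2 * mu * (mu + q) + mu ^+ 2 <= 3 * (e * mu ^+ 2) by lra.
have b2 : mu + q + (E2 + (mu + q) - EY) <= 18 * (e * mu ^+ 2) by lra.
have : (1 + 2 / d) * (E2 - 2 * mu * (mu + q) + mu ^+ 2) <= (1 + 2 / d) * (3 * (e * mu ^+ 2)).
  by rewrite ler_wpM2l //; lra.
have : 0 <= 2 / d * (e * mu ^+ 2) by apply: mulr_ge0 => //; apply: mulr_ge0; apply: ltW.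
lra.
Qed.

(** With [u = q ^+ 2 * th * h <= e] the union bound is nearly sharp: [1 - rho ^+ h] is at least
    [u * (1 - e)], and [th * (1 - e)] is at least [1 - 9 * e]. *)
Lemma expr_sub_ge (h : nat) : (h <= N)%N ->
  q ^+ 2 * (1 - 9 * e) * h%:R <= 1 - rho ^+ h.
Proof.
move=> hN; have /andP[q20 q21] := q2_bounds q01; have /andP[t0 t1] := th_bounds q01.
have tg := theta_ge q01 qe; case/andP: (e01) => e0 e1.
have r01 : 0 <= q ^+ 2 * th <= 1.
  by apply/andP; split; [apply: mulr_ge0|apply: mulr_ile1] => //; apply: ltW.
have := exprB1_le h r01; set u := q ^+ 2 * th * h%:R.
have u0 : 0 <= u by rewrite mulr_ge0 //; case/andP: r01.
have ue : u <= e.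
  apply: le_trans Nq2; rewrite /u mulrC ler_pM //; first by case/andP: r01.
    by rewrite ler_nat.
  by rewrite ler_piMr // ltW.
have r0 := exprn_ge0 h (proj1 (andP (rho_bounds q01))); move=> ru.
apply: (@le_trans _ _ (u * (1 - e))).
  have -> : u * (1 - e) = q ^+ 2 * (th * (1 - e)) * h%:R by rewrite /u; ring.
  by rewrite ler_wpM2r // ler_pM2l //; nra.
nra.
Qed.

Lemma Ex_card_sumset_ge : (1 - 9 * e) * mu ^+ 2 <= Ex (fun A => 2 * card_sumset R A).
Proof.
have cE A : card_sumset R A = \sum_(k < (2 * N).+1) (1 - (~~ has_sum A k)%:R).
  rewrite /card_sumset card_sumsetE natr_sum; apply: eq_bigr => k _.
  by rewrite (natr_negb R (has_sum A k)) opprB addrC subrK.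
under eq_Ex do rewrite cE.
rewrite ExZ Ex_sum; apply: (@le_trans _ _
  (2 * \sum_(k < (2 * N).+1) q ^+ 2 * (1 - 9 * e) * (halfgap N k)%:R)).
  case/andP: (e01) => e0 e1.
  rewrite -mulr_sumr sum_halfgap_nat -natr1 exprMn.
  have : 0 <= N%:R * (q ^+ 2 * (1 - 9 * e)) :> R.
    by apply: mulr_ge0 => //; apply: mulr_ge0; [exact: sqr_ge0|lra].
  nra.
rewrite ler_pM2l // ler_sum // => k _; rewrite ExB Ex_const.
apply: le_trans (expr_sub_ge _) _; last first.
  by rewrite lerD2l lerN2 Ex_nhas_sum_le //; have := ltn_ord k; lia.
by have := ltn_ord k; rewrite /halfgap; lia.
Qed.

Lemma Ex_card_diffset_ge : (1 - 9 * e) * mu ^+ 2 <= Ex (card_diffset R (N := N)).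
Proof.
have cE A : 2 * (\sum_(d < N) (1 - (~~ has_diff A d.+1)%:R)) <= card_diffset R A.
  rewrite /card_diffset card_diffsetE -muln2 natrD mulrC natrM natr_sum.
  rewrite -[leLHS]addr0 lerD // ler_pM2r // ler_sum // => k _.
  by rewrite (natr_negb R (has_diff A k.+1)) opprB addrC subrK.
apply: le_trans (Ex_le q01 cE).
rewrite ExZ Ex_sum; apply: (@le_trans _ _
  (2 * \sum_(d < N) q ^+ 2 * (1 - 9 * e) * (N - d)%:R)).
  case/andP: (e01) => e0 e1.
  have -> : \sum_(d < N) q ^+ 2 * (1 - 9 * e) * (N - d)%:R =
      q ^+ 2 * (1 - 9 * e) * (N%:R * (N%:R + 1) / 2) :> R.
    rewrite -mulr_sumr; congr (_ * _); elim: (N) => [|n IH].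
      by rewrite big_ord0 !mul0r.
    rewrite big_ord_recl subn0; under eq_bigr do rewrite lift0 subSS.
    by rewrite IH -natr1; field.
  rewrite exprMn; have : 0 <= N%:R * (q ^+ 2 * (1 - 9 * e)) :> R.
    by apply: mulr_ge0 => //; apply: mulr_ge0; [exact: sqr_ge0|lra].
  nra.
rewrite ler_pM2l // ler_sum // => k _; rewrite ExB Ex_const.
apply: le_trans (expr_sub_ge _) _; first by rewrite leq_subr.
by rewrite lerD2l lerN2 -subSS Ex_nhas_diff_le.
Qed.

Lemma card_sumset_conc (d : R) : 0 < d ->
  binomial_model q (fun A : {set 'I_N.+1} =>
    ~~ (`|2 * card_sumset R A - mu ^+ 2| <= d * mu ^+ 2)) <= 42 * (1 + 2 / d) * e / d.
Proof. move=> d0; exact: (sparse_conc d0 (@card_sumset_le R N) Ex_card_sumset_ge). Qed.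

Lemma card_diffset_conc (d : R) : 0 < d ->
  binomial_model q (fun A : {set 'I_N.+1} =>
    ~~ (`|card_diffset R A - mu ^+ 2| <= d * mu ^+ 2)) <= 42 * (1 + 2 / d) * e / d.
Proof.
move=> d0; apply: (sparse_conc d0 _ Ex_card_diffset_ge) => A.
by apply: le_trans (card_diffset_le R A) _; rewrite lerDl.
Qed.

End Sparse.

(** * Asymptotics *)

Section BinomialModel.
Variables (R : realType) (N : nat) (q : R).
Hypothesis q01 : 0 < q < 1.
Implicit Types E : pred {set 'I_N.+1}.

Lemma binomial_le E E' : (forall A, E A -> E' A) -> binomial_model q E <= binomial_model q E'.
Proof.
move=> EE'; rewrite !binomial_modelE; apply: Ex_le => // A; rewrite ler_nat.
by case: (boolP (E A)) => // /EE' ->.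
Qed.

Lemma binomial_union E E1 E2 : (forall A, E A -> E1 A || E2 A) ->
  binomial_model q E <= binomial_model q E1 + binomial_model q E2.
Proof.
move=> EE; rewrite !binomial_modelE -ExD; apply: Ex_le => // A.
rewrite -natrD ler_nat; case: (boolP (E A)) => // /EE.
by case: (E1 A); case: (E2 A).
Qed.

Lemma binomial_negb E : binomial_model q E = 1 - binomial_model q (fun A => ~~ E A).
Proof.
rewrite !binomial_modelE.
transitivity (Ex q (fun A => 1 - (~~ E A)%:R)); last by rewrite ExB Ex_const.
by apply: eq_Ex => A; rewrite (natr_negb R (E A)) subKr.
Qed.

Lemma binomial_ge0 E : 0 <= binomial_model q E.
Proof. by rewrite binomial_modelE; apply: Ex_ge0. Qed.

End BinomialModel.

(** * Calculus of concentration statements *)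

Section Concentration.
Variables (R : realType) (p : nat -> R).
Hypothesis p01 : forall N, 0 < p N < 1.
Implicit Types (X Y : Defs.random_variable R) (f h : nat -> R).

(** The relation [sim] with a deterministic target, phrased with an absolute value and a filter. *)
Definition conc X f := forall e1 e2 : R, 0 < e1 -> 0 < e2 -> \forall N \near \oo,
  binomial_model (p N) (fun A => ~~ (`|X N A - f N| <= e1 * f N)) < e2.

Lemma conc_sim X f : conc X f -> sim p X (deterministic f).
Proof.
move=> Xf e1 e2 e10 e20; have [N0 _ H] := Xf _ _ e10 e20.
exists N0 => N /ltnW /H /=; congr (_ < _); apply: eq_bigl => A.
by rewrite /in_mem /= /deterministic ler_distl mulrBl mulrDl !mul1r.
Qed.

Lemma conc_sim2 X Y f : (\forall N \near \oo, 0 <= f N) ->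
  conc X f -> conc Y f -> sim p X Y.
Proof.
(* This [d] solves [(1 + d) = (1 + e1) * (1 - d)], so closeness of both variables to [f] within [d]
   suffices. *)
move=> f0 Xf Yf e1 e2 e10 e20; pose d := e1 / (2 + e1).
have d0 : 0 < d by rewrite divr_gt0 // addr_gt0.
have dE : d * (2 + e1) = e1 by rewrite divfK // lt0r_neq0 // addr_gt0.
have e20' : 0 < e2 / 2 by rewrite divr_gt0.
have [N0 _ H] : \forall N \near \oo, binomial_model (p N)
    (fun A => ~~ ((1 - e1) * Y N A <= X N A <= (1 + e1) * Y N A)) < e2.
  near=> N.
  rewrite [ltRHS](splitr e2).
  have hX : binomial_model (p N) (fun A => ~~ (`|X N A - f N| <= d * f N)) < e2 / 2.
    by near: N; exact: Xf.
  have hY : binomial_model (p N) (fun A => ~~ (`|Y N A - f N| <= d * f N)) < e2 / 2.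
    by near: N; exact: Yf.
  have fN : 0 <= f N by near: N.
  apply: le_lt_trans (ltrD hX hY); apply: binomial_union => // A.
  rewrite -negb_and; apply: contra => /andP[]; rewrite !ler_distl.
  move=> /andP[a1 a2] /andP[b1 b2].
  have : e1 * ((1 - d) * f N) <= e1 * Y N A by rewrite ler_pM2l //; lra.
  have : d * (2 + e1) * f N = e1 * f N by rewrite dE.
  by move=> *; apply/andP; split; lra.
by exists N0 => N /ltnW /H.
Unshelve. all: by end_near.
Qed.

(** Replaces the exact centre [f] by an asymptotic [h]: half of the tolerance goes to the deviation
    of [X], half to the error term. *)
Lemma conc_transfer X Y f h (a C : R) : 0 <= a -> 0 <= C -> conc X f ->
    (\forall N \near \oo, 0 <= h N /\ f N <= C * h N) ->
    (forall d, 0 < d -> \forall N \near \oo, forall A,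
      `|Y N A - h N| <= a * `|X N A - f N| + d * h N) ->
  conc Y h.
Proof.
move=> a0 C0 Xf fh XY e1 e2 e10 e20.
have b0 : 0 < a * C + 1 by rewrite ltr_wpDl // mulr_ge0.
pose d := e1 / 2 / (a * C + 1).
have d0 : 0 < d by rewrite !divr_gt0.
have dE : d * (a * C + 1) = e1 / 2 by rewrite divfK // lt0r_neq0.
have e10' : 0 < e1 / 2 by rewrite divr_gt0.
near=> N.
have [h0 fhN] : 0 <= h N /\ f N <= C * h N by near: N.
have XYN : forall A, `|Y N A - h N| <= a * `|X N A - f N| + e1 / 2 * h N.
  by near: N; exact: XY.
have hX : binomial_model (p N) (fun A => ~~ (`|X N A - f N| <= d * f N)) < e2.
  by near: N; exact: Xf.
apply: le_lt_trans hX; apply: binomial_le => // A; apply: contra => XA.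
apply: le_trans (XYN A) _.
have : a * `|X N A - f N| <= a * (d * (C * h N)).
  by rewrite ler_wpM2l // (le_trans XA) // ler_pM2l.
have : d * (a * C + 1) * h N = e1 / 2 * h N by rewrite dE.
have : 0 <= d * h N by rewrite mulr_ge0 // ltW.
lra.
Unshelve. all: by end_near.
Qed.

End Concentration.

Section Asymptotics.
Variables (R : realType) (p : nat -> R).
Hypothesis p01 : forall N, 0 < p N < 1.
Hypotheses (p_lower : is_o (fun N : nat => N%:R^-1) p) (p_upper : is_o p (fun _ : nat => 1)).
Local Notation mu N := (N%:R * p N).

Lemma is_o_norm_le (f g : nat -> R) (e : R) : is_o f g -> 0 < e ->
  (forall N, 0 < g N) -> \forall N \near \oo, f N <= e * g N.
Proof.
move=> fg e0 g0; near=> N; rewrite -ler_pdivrMr //.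
apply: le_trans (ler_norm _) _; near: N; exact: cvgr0_norm_le.
Unshelve. all: by end_near.
Qed.

Lemma near_mu (e : R) : 0 < e -> \forall N \near \oo, 1 <= e * mu N.
Proof.
move=> e0; near=> N; have N0 : 0 < N%:R :> R by near: N; exact: nbhs_infty_gtr.
rewrite mulrCA -ler_pdivrMl // mulr1; near: N; apply: is_o_norm_le => // N.
by case/andP: (p01 N).
Unshelve. all: by end_near.
Qed.

Lemma near_p (e : R) : 0 < e -> \forall N \near \oo, p N <= e.
Proof. by move=> e0; rewrite -[e]mulr1; exact: is_o_norm_le. Qed.

Lemma conc_missing_sums :
  conc p (missing_sums R) (fun N => 4 * geo (p N ^+ 2) N./2).
Proof.
(* Chosen so that the Chebyshev bound [2000 * e / (4 * e1) ^+ 2] is below [e2]; the tolerance is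
   [4 * e1] because the centre is four times [geo]. *)
move=> e1 e2 e10 e20; pose e := Num.min (1 / 100) (e1 ^+ 2 * e2 / 100 / 100).
have ee : 0 < e1 ^+ 2 * e2 by rewrite mulr_gt0 // exprn_gt0.
have e0 : 0 < e by rewrite lt_min; apply/andP; split; lra.
have e01 : 0 < e <= 1 / 100 by rewrite e0 ge_min lexx.
have d0 : 0 < 4 * e1 by rewrite mulr_gt0.
near=> N.
have Np : 1 <= e * mu N by near: N; exact: near_mu.
have pe : p N <= e by near: N; exact: near_p.
have h := missing_sums_conc (p01 N) e01 Np pe d0.
under eq_fun do rewrite mulrA [_ * 4]mulrC.
apply: le_lt_trans h _; rewrite ltr_pdivrMr ?exprn_gt0 //.
have : e <= e1 ^+ 2 * e2 / 100 / 100 by rewrite ge_min lexx orbT.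
by rewrite exprMn; lra.
Unshelve. all: by end_near.
Qed.

Lemma conc_missing_diffs :
  conc p (missing_diffs R) (fun N => 2 * geo (p N ^+ 2) N).
Proof.
move=> e1 e2 e10 e20.
pose e := Num.min (1 / 100) (Num.min e1 (e1 ^+ 2 * e2 / 100 / 100 / 10)).
have ee : 0 < e1 ^+ 2 * e2 by rewrite mulr_gt0 // exprn_gt0.
have e0 : 0 < e by rewrite !lt_min e10 /=; apply/andP; split; lra.
have e01 : 0 < e <= 1 / 100 by rewrite e0 ge_min lexx.
have d0 : 0 < 2 * e1 by rewrite mulr_gt0.
have ed : 2 * e <= 2 * e1 by rewrite ler_pM2l // !ge_min lexx orbT.
near=> N.
have Np : 1 <= e * mu N by near: N; exact: near_mu.
have pe : p N <= e by near: N; exact: near_p.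
have h := missing_diffs_conc (p01 N) e01 Np pe d0 ed.
under eq_fun do rewrite mulrA [_ * 2]mulrC.
apply: le_lt_trans h _; rewrite ltr_pdivrMr ?exprn_gt0 //.
have : e <= e1 ^+ 2 * e2 / 100 / 100 / 10 by rewrite !ge_min lexx !orbT.
by rewrite exprMn; lra.
Unshelve. all: by end_near.
Qed.

(** The threshold [e] on [N * p N ^+ 2] is independent of [N], so the statement applies to
    individual [N] even when that product has no limit. *)
Lemma sparse_regime (e1 e2 : R) : 0 < e1 -> 0 < e2 ->
  exists2 e, 0 < e & \forall N \near \oo, mu N * p N <= e ->
    binomial_model (p N)
      (fun A : {set 'I_N.+1} => ~~ (`|2 * card_sumset R A - mu N ^+ 2| <= e1 * mu N ^+ 2)) < e2 /\
    binomial_model (p N)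
      (fun A : {set 'I_N.+1} => ~~ (`|card_diffset R A - mu N ^+ 2| <= e1 * mu N ^+ 2)) < e2.
Proof.
move=> e10 e20; pose c := 42 * (1 + 2 / e1) / e1.
have c0 : 0 < c by rewrite divr_gt0 // mulr_gt0 // addr_gt0 // divr_gt0.
pose e := Num.min (1 / 100) (e2 / 2 / c).
have e0 : 0 < e by rewrite lt_min; apply/andP; split; apply: divr_gt0 => //; apply: divr_gt0.
have e01 : 0 < e <= 1 / 100 by rewrite e0 ge_min lexx.
exists e => //; near=> N; rewrite -mulrA -expr2 => Np2.
have Np : 1 <= e * mu N by near: N; exact: near_mu.
have pe : p N <= e by near: N; exact: near_p.
have ce : 42 * (1 + 2 / e1) * e / e1 < e2.
  rewrite mulrAC -/c mulrC -ltr_pdivlMr //.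
  apply: (@le_lt_trans _ _ (e2 / 2 / c)); first by rewrite ge_min lexx orbT.
  by rewrite ltr_pM2r ?invr_gt0 //; lra.
by split; apply: le_lt_trans ce; [apply: card_sumset_conc|apply: card_diffset_conc].
Unshelve. all: by end_near.
Qed.

Lemma near_geo (e : R) : 0 < e -> \forall N \near \oo,
  1 <= e * geo (p N ^+ 2) N./2.
Proof.
move=> e0; pose d := Num.min (1 / 100) e.
have d0 : 0 < d by rewrite lt_min e0 divr_gt0.
have d01 : 0 < d <= 1 / 100 by rewrite d0 ge_min lexx.
near=> N.
have Np : 1 <= d * mu N by near: N; exact: near_mu.
have pe : p N <= d by near: N; exact: near_p.
apply: le_trans (geo_half_large (p01 N) d01 Np pe) _.
rewrite ler_wpM2r ?geo_ge0 //; last by rewrite ge_min lexx orbT.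
by case/andP: (p01 N) => *; rewrite exprn_ile1 // ltW.
Unshelve. all: by end_near.
Qed.

End Asymptotics.

(** * Difference dominance and the two extreme regimes *)

Section Regimes.
Variables (R : realType) (p : nat -> R).
Hypothesis p01 : forall N, 0 < p N < 1.
Hypotheses (p_lower : is_o (fun N : nat => N%:R^-1) p) (p_upper : is_o p (fun _ : nat => 1)).
Local Notation mu N := (N%:R * p N).

Lemma p2_bounds N : 0 < p N ^+ 2 <= 1.
Proof. exact: q2_bounds. Qed.

Lemma half_lower N : (1 < N)%N -> N%:R <= 4 * (N./2)%:R :> R.
Proof. by move=> N1; rewrite -natrM ler_nat; lia. Qed.

Lemma difference_dominatedE N (A : {set 'I_N.+1}) :
  difference_dominated (to_ints A) = (card_sumset R A < card_diffset R A).
Proof. by rewrite ltr_nat. Qed.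

Lemma geo_full_le N s : 0 < s <= 1 ->
  geo s N <= geo s N./2 * (1 + (1 - s) ^+ N./2) + 1 :> R.
Proof.
move=> /andP[s0 s1]; rewrite -geo_double addnn.
have [-> | ->] : N = N./2.*2 \/ N = N./2.*2.+1 by lia.
  by rewrite doubleK lerDl.
by rewrite geoS /= uphalf_double lerD2l exprn_ile1 ?subr_ge0 // gerBl ltW.
Qed.

(** [N * p N ^+ 2] may oscillate, so the three regimes do not cover all [p]. Each large [N] is
    treated as sparse or not, according to the threshold [c]. *)
Lemma near_difference_dominated (e : R) : 0 < e -> \forall N \near \oo,
  binomial_model (p N) (fun A : {set 'I_N.+1} => ~~ difference_dominated (to_ints A)) < e.
Proof.
move=> e0; have e20 : 0 < e / 2 by rewrite divr_gt0.
have t0 : 0 < 1 / 10 :> R by lra.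
have [c c0 [M1 _ sparse]] := sparse_regime p01 p_lower p_upper t0 e20.
(* Above the threshold [p N ^+ 2 * N./2] is at least [c / 4], so [exprB1_le] bounds
   [(1 - p N ^+ 2) ^+ N./2] by [1 - k]. *)
pose k := (c / 4) / (1 + c / 4).
have k0 : 0 < k by rewrite !divr_gt0 // addr_gt0 // divr_gt0.
have k1 : k < 1 by rewrite ltr_pdivrMr ?mul1r ?ltrDr // addr_gt0 // divr_gt0.
have d0 : 0 < k / 16 by rewrite divr_gt0.
have k80 : 0 < k / 8 by rewrite divr_gt0.
have [M2 _ dS] := conc_missing_sums p01 p_lower p_upper d0 e20.
have [M3 _ dD] := conc_missing_diffs p01 p_lower p_upper d0 e20.
near=> N.
rewrite [ltRHS](splitr e).
have [small|large] := lerP (mu N * p N) c.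
  have M1N : (M1 <= N)%N by near: N; exact: nbhs_infty_ge.
  have [hS hD] := sparse N M1N small.
  apply: le_lt_trans (ltrD hS hD); apply: binomial_union => // A.
  rewrite difference_dominatedE -leNgt -negb_and => DS; apply/negP => /andP[].
  have mu0 : 0 < mu N ^+ 2.
    rewrite exprn_gt0 // mulr_gt0 //; last by case/andP: (p01 N).
    by near: N; exact: nbhs_infty_gtr.
  by rewrite !ler_distl => /andP[_ a] /andP[b _]; lra.
have M2N : (M2 <= N)%N by near: N; exact: nbhs_infty_ge.
have M3N : (M3 <= N)%N by near: N; exact: nbhs_infty_ge.
have hS := dS N M2N; have hD := dD N M3N.
apply: le_lt_trans (ltrD hS hD); apply: binomial_union => // A.
rewrite difference_dominatedE -leNgt -negb_and => DS; apply/negP => /andP[].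
rewrite !ler_distl /missing_sums /missing_diffs => /andP[a _] /andP[_ b].
have N1 : (1 < N)%N by near: N; exact: nbhs_infty_gt.
have Fk : 1 <= k / 8 * geo (p N ^+ 2) N./2 by near: N; exact: near_geo.
have FN := geo_full_le N (p2_bounds N).
have /andP[s0 s1] := p2_bounds N.
have s01 : 0 <= p N ^+ 2 <= 1 by rewrite ltW.
have w1 := exprB1_le N./2 s01.
have w0 : 0 <= (1 - p N ^+ 2) ^+ N./2 by rewrite exprn_ge0 // subr_ge0.
have sM : c / 4 <= p N ^+ 2 * N./2%:R.
  have : mu N * p N <= 4 * (N./2)%:R * p N ^+ 2.
    by rewrite -mulrA -expr2 ler_wpM2r ?half_lower // ltW.
  by lra.
set w := _ ^+ N./2 in FN w1 w0; set F := geo _ N./2 in a FN Fk.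
have wk : w <= 1 - k.
  have -> : 1 - k = (1 + c / 4)^-1 by rewrite /k; field; lra.
  rewrite -[leRHS]mul1r ler_pdivlMr; last by lra.
  apply: le_trans w1; rewrite ler_wpM2l //; lra.
(* Missing sums number about [4 * F], missing differences at most about [(4 - 2 * k) * F]. The gap
   beats the tolerances [k / 16] and the parity error because [k * F] is at least 8. *)
have F0 : 0 < F by rewrite -(pmulr_rgt0 _ k80); lra.
have Fw : F * w <= F * (1 - k) by rewrite ler_pM2l.
have kFN : k / 16 * (2 * geo (p N ^+ 2) N) <= k / 16 * (2 * (2 * F + 1)).
  by rewrite ler_pM2l //; nra.
nra.
Unshelve. all: by end_near.
Qed.

Lemma cvg_difference_dominated :
  (fun N : nat => binomial_model (p N)
      (fun A : {set 'I_N.+1} => difference_dominated (to_ints A))) @ \oo --> (1 : R).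
Proof.
apply/cvgrPdist_le => e e0; near=> N.
rewrite binomial_negb // subKr ger0_norm ?binomial_ge0 //.
by apply: ltW; near: N; exact: near_difference_dominated.
Unshelve. all: by end_near.
Qed.

Lemma powR_half_sqr N : (0 < N)%N -> (N%:R `^ (- (1 / 2)) : R) ^+ 2 = N%:R^-1.
Proof.
move=> N0; rewrite -powR_mulrn ?powR_ge0 // -powRrM.
by rewrite (_ : - (1 / 2) * 2 = -1) ?powR_inv1 //; lra.
Qed.

Lemma sparse_conc_card : is_o p (fun N : nat => N%:R `^ (- (1 / 2))) ->
  conc p (twice (card_sumset R)) (fun N => mu N ^+ 2) /\
  conc p (card_diffset R) (fun N => mu N ^+ 2).
Proof.
move=> po; have small (e : R) : 0 < e -> \forall N \near \oo, mu N * p N <= e.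
  move=> e0; near=> N; have N0 : (0 < N)%N by near: N; exact: nbhs_infty_gt.
  have h : `|p N / N%:R `^ (- (1 / 2))| <= Num.sqrt e.
    by near: N; apply: cvgr0_norm_le => //; rewrite sqrtr_gt0.
  have : `|p N / N%:R `^ (- (1 / 2))| ^+ 2 <= Num.sqrt e ^+ 2.
    by rewrite lerXn2r ?nnegrE ?sqrtr_ge0.
  rewrite (sqr_sqrtr (ltW e0)) (real_normK (num_real _)) exprMn exprVn powR_half_sqr // invrK.
  by rewrite (_ : mu N * p N = p N ^+ 2 * N%:R) //; ring.
split=> e1 e2 e10 e20; have [c c0 [M _ H]] := sparse_regime p01 p_lower p_upper e10 e20;
  near=> N; 
  have Nc : mu N * p N <= c by [near: N; exact: small];
  have MN : (M <= N)%N by [near: N; exact: nbhs_infty_ge];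
  by have [] := H N MN Nc.
Unshelve. all: by end_near.
Qed.

Lemma sparse_sim : is_o p (fun N : nat => N%:R `^ (- (1 / 2))) ->
  [/\ sim p (card_sumset R) (deterministic (fun N => mu N ^+ 2 / 2)),
      sim p (card_diffset R) (twice (card_sumset R)) &
      sim p (twice (card_sumset R)) (deterministic (fun N => mu N ^+ 2))].
Proof.
move=> /sparse_conc_card[cS cD]; split; last exact: conc_sim.
  apply: conc_sim; apply: (@conc_transfer _ _ p01 _ _ _ _ (1 / 2) 2 _ _ cS) => //.
  - by near=> N; split; [rewrite divr_ge0 ?sqr_ge0|lra].
  move=> d d0; near=> N => A; rewrite /twice.
  have -> : card_sumset R A - mu N ^+ 2 / 2 = 1 / 2 * (2 * card_sumset R A - mu N ^+ 2).
    by field.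
  rewrite normrM ger0_norm ?lerDl; last by lra.
  by rewrite mulr_ge0 ?divr_ge0 ?sqr_ge0 // ltW.
by apply: conc_sim2 cD cS => //; near=> N; exact: sqr_ge0.
Unshelve. all: by end_near.
Qed.

(** Here [N * p N ^+ 2] tends to infinity, so the power in the closed form of [geo] vanishes and
    both [4 * geo (p N ^+ 2) N./2] and [4 * geo (p N ^+ 2) N] approach [4 / p N ^+ 2]. *)
Lemma dense_sim : is_o (fun N : nat => N%:R `^ (- (1 / 2))) p ->
  sim p (missing_sums R) (twice (missing_diffs R)) /\
  sim p (twice (missing_diffs R)) (deterministic (fun N => 4 / p N ^+ 2)).
Proof.
move=> po.
have pow_small (d : R) : 0 < d -> \forall N \near \oo, (1 - p N ^+ 2) ^+ N./2 <= d.
  move=> d0; have d40 : 0 < d / 4 by rewrite divr_gt0.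
  have sd0 : 0 < Num.sqrt (d / 4) by rewrite sqrtr_gt0.
  near=> N; have N1 : (1 < N)%N by near: N; exact: nbhs_infty_gt.
  have /andP[s0 s1] := p2_bounds N.
  have p0 : 0 < p N by case/andP: (p01 N).
  have h : N%:R `^ (- (1 / 2)) <= Num.sqrt (d / 4) * p N.
    by near: N; apply: is_o_norm_le => // N; case/andP: (p01 N).
  have : (N%:R `^ (- (1 / 2))) ^+ 2 <= (Num.sqrt (d / 4) * p N) ^+ 2.
    by rewrite lerXn2r // nnegrE ?powR_ge0 // mulr_ge0 ?sqrtr_ge0 // ltW.
  rewrite exprMn (sqr_sqrtr (ltW d40)) powR_half_sqr //; last by lia.
  have N0 : 0 < N%:R :> R by rewrite ltr0n; lia.
  rewrite -[leLHS]mul1r ler_pdivrMr // => dN.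
  have sM : 1 <= d * (p N ^+ 2 * N./2%:R).
    have : d / 4 * p N ^+ 2 * N%:R <= d / 4 * p N ^+ 2 * (4 * N./2%:R).
      by rewrite ler_pM2l ?half_lower // mulr_gt0.
    by lra.
  have s01 : 0 <= p N ^+ 2 <= 1 by rewrite ltW.
  have w1 := exprB1_le N./2 s01.
  have w0 : 0 <= (1 - p N ^+ 2) ^+ N./2 by rewrite exprn_ge0 // subr_ge0.
  have : (1 - p N ^+ 2) ^+ N./2 * 1 <= (1 - p N ^+ 2) ^+ N./2 * (d * (p N ^+ 2 * N./2%:R)).
    exact: ler_wpM2l.
  have : d * ((1 - p N ^+ 2) ^+ N./2 * (1 + p N ^+ 2 * N./2%:R)) <= d * 1 by rewrite ler_pM2l.
  have : 0 <= d * (1 - p N ^+ 2) ^+ N./2 by rewrite mulr_ge0 // ltW.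
  by lra.
have geoE N M : geo (p N ^+ 2) M = (1 - (1 - p N ^+ 2) ^+ M) / p N ^+ 2.
  have /andP[s0 _] := p2_bounds N.
  by rewrite -mul_geo mulrAC divff ?mul1r // lt0r_neq0.
have w0 N M : 0 <= (1 - p N ^+ 2) ^+ M.
  by have /andP[_ s1] := p2_bounds N; rewrite exprn_ge0 // subr_ge0.
have wle N : (1 - p N ^+ 2) ^+ N <= (1 - p N ^+ 2) ^+ N./2.
  have /andP[s0 s1] := p2_bounds N.
  by apply: ler_wiXn2l; [rewrite subr_ge0|rewrite gerBl ltW|lia].
have cS : conc p (missing_sums R) (fun N => 4 / p N ^+ 2).
  apply: (@conc_transfer _ _ p01 _ _ _ _ 1 1 _ _ (conc_missing_sums p01 p_lower p_upper)) => //.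
    near=> N; have /andP[s0 _] := p2_bounds N; split; first by rewrite divr_ge0 // ltW.
    rewrite mul1r geoE mulrA ler_pM2r ?invr_gt0 //; have := w0 N N./2; lra.
  move=> d d0; near=> N => A; have /andP[s0 _] := p2_bounds N; rewrite mul1r.
  apply: le_trans (ler_distD (4 * geo (p N ^+ 2) N./2) _ _) _; rewrite lerD2l.
  have -> : 4 * geo (p N ^+ 2) N./2 - 4 / p N ^+ 2 =
      - ((1 - p N ^+ 2) ^+ N./2 * (4 / p N ^+ 2)).
    by rewrite geoE; field; case/andP: (p01 N) => /lt0r_neq0.
  have q0 : 0 < 4 / p N ^+ 2 by rewrite divr_gt0.
  rewrite normrN ger0_norm; last by rewrite mulr_ge0 // ltW.
  by rewrite ler_pM2r //; near: N; exact: pow_small.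
have cD : conc p (twice (missing_diffs R)) (fun N => 4 / p N ^+ 2).
  apply: (@conc_transfer _ _ p01 _ _ _ _ 2 1 _ _ (conc_missing_diffs p01 p_lower p_upper)) => //.
    near=> N; have /andP[s0 _] := p2_bounds N; split; first by rewrite divr_ge0 // ltW.
    rewrite mul1r geoE mulrA ler_pM2r ?invr_gt0 //; have := w0 N N; lra.
  move=> d d0; near=> N => A; have /andP[s0 _] := p2_bounds N; rewrite /twice.
  apply: le_trans (ler_distD (2 * (2 * geo (p N ^+ 2) N)) _ _) _.
  rewrite -mulrBr normrM [X in X * _]ger0_norm // lerD2l.
  have -> : 2 * (2 * geo (p N ^+ 2) N) - 4 / p N ^+ 2 =
      - ((1 - p N ^+ 2) ^+ N * (4 / p N ^+ 2)).
    by rewrite geoE; field; case/andP: (p01 N) => /lt0r_neq0.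
  have q0 : 0 < 4 / p N ^+ 2 by rewrite divr_gt0.
  rewrite normrN ger0_norm; last by rewrite mulr_ge0 // ltW.
  by rewrite ler_pM2r //; apply: le_trans (wle N) _; near: N; exact: pow_small.
split; last exact: conc_sim.
apply: conc_sim2 cS cD => //; near=> N.
by have /andP[s0 _] := p2_bounds N; rewrite divr_ge0 // ltW.
Unshelve. all: by end_near.
Qed.

End Regimes.

(** * The critical regime *)

Lemma g_bounds (R : realType) (x : R) : 0 < x -> 0 < g x < 2.
Proof.
move=> x0; have h1 := @expR_gt1Dx R (- x); rewrite oppr_eq0 lt0r_neq0 // in h1.
have {}h1 := h1 isT; have h2 : expR (- x) < 1 by rewrite expR_lt1 oppr_lt0.
rewrite /g; apply/andP; split.
  by rewrite mulr_gt0 // divr_gt0 //; lra.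
by rewrite -[ltRHS]mulr1 ltr_pM2l // ltr_pdivrMr // mul1r; lra.
Qed.

Lemma expr_expR_bounds (R : realType) (s : R) M : 0 < s < 1 ->
  expR (- (s * M%:R / (1 - s))) <= (1 - s) ^+ M <= expR (- (s * M%:R)).
Proof.
move=> /andP[s0 s1]; have s1' : 0 < 1 - s by rewrite subr_gt0.
rewrite (_ : s * M%:R / (1 - s) = M%:R * (s / (1 - s))); last by ring.
rewrite [s * M%:R]mulrC -!(mulrN M%:R) !expRM_natl; apply/andP; split.
  apply: lerXn2r; [by rewrite nnegrE expR_ge0|by rewrite nnegrE ltW|].
  (* [1 - s] is the inverse of [1 + s / (1 - s)], so the lower bound too follows from
     [1 + y <= expR y]. *)
  rewrite expRN invf_ple ?posrE ?expR_gt0 //.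
  apply: le_trans (expR_ge1Dx (s / (1 - s))).
  by rewrite le_eqVlt; apply/orP; left; apply/eqP; field; exact: lt0r_neq0.
apply: lerXn2r; [by rewrite nnegrE ltW|by rewrite nnegrE expR_ge0|].
exact: expR_ge1Dx.
Qed.

Lemma cvg_expr_expR (R : realType) (s : nat -> R) (M : nat -> nat) (l : R) :
    (forall N, 0 < s N < 1) -> s @ \oo --> (0 : R) ->
    (fun N => s N * (M N)%:R) @ \oo --> l ->
  (fun N => (1 - s N) ^+ M N) @ \oo --> expR (- l).
Proof.
move=> s01 s0 sM.
apply: (@squeeze_cvgr _ _ _ _ (fun N => expR (- (s N * (M N)%:R / (1 - s N))))
  (fun N => expR (- (s N * (M N)%:R)))).
- by near=> N; exact: expr_expR_bounds.
- apply: continuous_cvg; first exact: continuous_expR.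
  apply: cvgN; rewrite -[l]divr1; apply: cvgM => //; apply: cvgV => //.
  by rewrite -[X in _ --> X]subr0; apply: cvgB => //; exact: cvg_cst.
- apply: continuous_cvg; first exact: continuous_expR.
  exact: cvgN.
Unshelve. all: by end_near.
Qed.

Section Critical.
Variables (R : realType) (p : nat -> R).
Hypothesis p01 : forall N, 0 < p N < 1.
Hypotheses (p_lower : is_o (fun N : nat => N%:R^-1) p) (p_upper : is_o p (fun _ : nat => 1)).
Variable c : R.
Hypotheses (c0 : 0 < c) (pc : \forall N \near \oo, p N = c * N%:R `^ (- (1 / 2))).

Lemma critical_p2 : \forall N \near \oo, p N ^+ 2 * N%:R = c ^+ 2.
Proof.
near=> N; have N0 : (0 < N)%N by near: N; exact: nbhs_infty_gt.
have -> : p N = c * N%:R `^ (- (1 / 2)) by near: N.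
by rewrite exprMn powR_half_sqr // divfK // pnatr_eq0 -lt0n.
Unshelve. all: by end_near.
Qed.

Lemma cvg_p2 : (fun N => p N ^+ 2) @ \oo --> (0 : R).
Proof.
rewrite -[X in _ --> X](mulr0 0).
have p0 : p @ \oo --> (0 : R).
  by apply: cvg_trans p_upper; apply: near_eq_cvg; near=> N; rewrite divr1.
by under eq_fun do rewrite expr2; exact: cvgM.
Unshelve. all: by end_near.
Qed.

(** Treats sums ([b = 4], [M = N./2]) and differences ([b = 2], [M = N]) together. With
    [x = 2 / b * c ^+ 2], subtracting the limiting count of missing values from [2 * N] leaves
    [g x * N]. *)
Lemma critical_conc (X : Defs.random_variable R) (b : R) (M : nat -> nat) :
    0 < b -> (forall N, (M N <= N)%N) ->
    (fun N => p N ^+ 2 * (M N)%:R) @ \oo --> 2 / b * c ^+ 2 ->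
    conc p (fun N A => (2 * N + 1)%:R - X N A) (fun N => b * geo (p N ^+ 2) (M N)) ->
  conc p X (fun N => g (2 / b * c ^+ 2) * N%:R).
Proof.
move=> b0 MN cvM cX; set x := 2 / b * c ^+ 2 in cvM *.
have x0 : 0 < x by rewrite mulr_gt0 ?divr_gt0 ?exprn_gt0.
have /andP[g0 _] := g_bounds x0.
apply: (@conc_transfer _ _ p01 _ _ _ _ 1 (b / g x) _ _ cX) => //.
- by rewrite divr_ge0 // ltW.
- near=> N; split; first by rewrite mulr_ge0 // ltW.
  rewrite mulrA divfK ?lt0r_neq0 // ler_pM2l //.
  apply: (@le_trans _ _ (M N)%:R); last by rewrite ler_nat.
  rewrite /geo -[leRHS]mulr1 mulr_natl -[in leRHS](card_ord (M N)) -sumr_const ler_sum // => i _.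
  have /andP[s0 s1] := p2_bounds p01 N.
  by rewrite exprn_ile1 ?subr_ge0 // gerBl ltW.
move=> d d0.
have cw : (fun N => (1 - p N ^+ 2) ^+ M N) @ \oo --> expR (- x).
  apply: cvg_expr_expR cvg_p2 cvM => N; case/andP: (p01 N) => q0 q1.
  by rewrite exprn_gt0 // exprn_ilt1 // ltW.
(* Makes [b * eta / c ^+ 2] equal to [d * g x / 2]; the other half of the tolerance absorbs the 1 in
   [2 * N + 1]. *)
pose eta := d * g x / 2 * c ^+ 2 / b.
have eta0 : 0 < eta.
  apply: divr_gt0 => //; apply: mulr_gt0; last exact: exprn_gt0.
  by apply: divr_gt0 => //; exact: mulr_gt0.
near=> N => A; rewrite mul1r.
have N0 : 0 < N%:R :> R by near: N; exact: nbhs_infty_gtr.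
have N1 : 2 / (d * g x) <= N%:R by near: N; exact: nbhs_infty_ger.
have pN : p N ^+ 2 * N%:R = c ^+ 2 by near: N; exact: critical_p2.
have hw : `|expR (- x) - (1 - p N ^+ 2) ^+ M N| <= eta.
  by near: N; exact: cvgr_dist_le.
set w := _ ^+ M N in hw.
have /andP[s0 s1] := p2_bounds p01 N.
have geoN : geo (p N ^+ 2) (M N) = (1 - w) / c ^+ 2 * N%:R.
  rewrite -mul_geo -pN; field; case/andP: (p01 N) => /lt0r_neq0 -> _.
  by rewrite (lt0r_neq0 N0).
have gE : g x * N%:R = 2 * N%:R - b * ((1 - expR (- x)) / c ^+ 2 * N%:R).
  by rewrite /g /x; field; rewrite !lt0r_neq0.
have -> : X N A - g x * N%:R =
    - ((2 * N + 1)%:R - X N A - b * geo (p N ^+ 2) (M N)) +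
    (1 - b * ((expR (- x) - w) / c ^+ 2 * N%:R)).
  by rewrite geoN gE natrD natrM; field; exact: lt0r_neq0.
apply: le_trans (ler_normD _ _) _; rewrite normrN lerD2l.
apply: le_trans (ler_normB _ _) _; rewrite normr1.
have h1 : 1 <= d * g x / 2 * N%:R.
  have : 2 <= N%:R * (d * g x) by rewrite -ler_pdivrMr // mulr_gt0.
  by lra.
have h2 : `|b * ((expR (- x) - w) / c ^+ 2 * N%:R)| <= d * g x / 2 * N%:R.
  rewrite !normrM (ger0_norm (ltW b0)) (ger0_norm (ltW N0)) mulrA ler_pM2r //.
  have ic0 : 0 < (c ^+ 2)^-1 by rewrite invr_gt0 exprn_gt0.
  rewrite (ger0_norm (ltW ic0)).
  apply: (@le_trans _ _ (b * (eta / c ^+ 2))).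
    by rewrite ler_pM2l // ler_pM2r.
  by rewrite le_eqVlt; apply/orP; left; apply/eqP; rewrite /eta; field; rewrite !lt0r_neq0.
lra.
Unshelve. all: by end_near.
Qed.

Lemma critical_sim :
  sim p (card_sumset R) (deterministic (fun N => g (c ^+ 2 / 2) * N%:R)) /\
  sim p (card_diffset R) (deterministic (fun N => g (c ^+ 2) * N%:R)).
Proof.
have cvN : (fun N => p N ^+ 2 * N%:R) @ \oo --> c ^+ 2.
  apply: (@cvg_trans _ ((fun=> c ^+ 2) @ \oo)); last exact: cvg_cst.
  by apply: near_eq_cvg; near=> N; apply/esym; near: N; exact: critical_p2.
split; apply: conc_sim.
  rewrite (_ : c ^+ 2 / 2 = 2 / 4 * c ^+ 2); last by field.
  apply: (critical_conc (M := fun N => N./2)) (conc_missing_sums p01 p_lower p_upper) => //.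
    by move=> N; lia.
  (* Halving loses a parity term, which is harmless since [p N ^+ 2] tends to 0. *)
  have -> : (fun N => p N ^+ 2 * (N./2)%:R) =
      (fun N => 2^-1 * (p N ^+ 2 * N%:R - p N ^+ 2 * (odd N)%:R)).
    apply/funext => N.
    have -> : N%:R = (odd N)%:R + N./2%:R * 2 :> R.
      by rewrite -{1}(odd_double_half N) natrD -muln2 natrM.
    by field.
  rewrite (_ : 2 / 4 * c ^+ 2 = 2^-1 * (c ^+ 2 - 0)); last by field.
  apply: cvgM; first exact: cvg_cst.
  apply: cvgB => //; apply: (@squeeze_cvgr _ _ _ _ (fun=> 0) (fun N => p N ^+ 2)).
  - near=> N; have /andP[s0 s1] := p2_bounds p01 N.
    apply/andP; split; first by rewrite mulr_ge0 // ltW.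
    by rewrite ler_piMr ?(ltW s0) // lern1 leq_b1.
  - exact: cvg_cst.
  - exact: cvg_p2.
rewrite (_ : c ^+ 2 = 2 / 2 * c ^+ 2) in cvN *; last by field.
exact: (critical_conc (M := id)) (conc_missing_diffs p01 p_lower p_upper).
Unshelve. all: by end_near.
Qed.

End Critical.

Unset Implicit Arguments.

(** In (ii) the equation for [p] is asked for large [N] only: with [c >= 1] it would contradict
    [p 1 < 1]. *)
Theorem theorem1p1 (R : realType) (p : nat -> R)
  (p01 : forall N : nat, 0 < p N < 1)
  (p_lower : is_o (fun N : nat => N%:R^-1) p)
  (p_upper : is_o p (fun _ : nat => 1)) :
  ((fun N : nat => binomial_model (p N)
      (fun A : {set 'I_N.+1} => difference_dominated (to_ints A)))
    @ \oo --> (1 : R))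
  /\
  (* (i) *)
  (is_o p (fun N : nat => N%:R `^ (- (1 / 2))) ->
    [/\ sim p (card_sumset R) (deterministic (fun N => (N%:R * p N) ^+ 2 / 2)),
        sim p (card_diffset R) (twice (card_sumset R)) &
        sim p (twice (card_sumset R))
          (deterministic (fun N => (N%:R * p N) ^+ 2))])
  /\
  (* (ii) *)
  ((forall x : R, 0 < x -> 0 < g x < 2) /\
   forall c : R, 0 < c ->
    (\forall N \near \oo, p N = c * N%:R `^ (- (1 / 2))) ->
    sim p (card_sumset R) (deterministic (fun N => g (c ^+ 2 / 2) * N%:R)) /\
    sim p (card_diffset R) (deterministic (fun N => g (c ^+ 2) * N%:R)))
  /\
  (* (iii) *)
  (is_o (fun N : nat => N%:R `^ (- (1 / 2))) p ->
    sim p (missing_sums R) (twice (missing_diffs R)) /\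
    sim p (twice (missing_diffs R)) (deterministic (fun N => 4 / (p N) ^+ 2))).
Proof.
split; first exact: cvg_difference_dominated.
split; first exact: sparse_sim.
split; last exact: dense_sim.
by split; [exact: g_bounds|move=> c c0 pc; exact: critical_sim].
Qed.
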